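(* Let $\beta=(\beta_1,\beta_2)\in(0,\infty)\times(1,\infty)$, $L>0$, and let $\bar\beta=2\beta_1\beta_2/(\beta_1+\beta_2)$. Assume that the design $(X,T)$ has a density $f_{(X,T)}$ with $h_1=\|f_{(X,T)}\|_\infty<\infty$. Then there exist a constant $c>0$ depending on $(\beta,L,h_1)$ and an integer $n_0$ such that for all $n\ge n_0$, $$\inf_{\widehat F_n}\ \sup_{F\in\mathcal B^\beta_{2,\infty}(A,L)}\mathbb E\left[n^{\bar\beta/(\bar\beta+1)}\|\widehat F_n-F\|^2\right]\ge c,$$ where the infimum is over all estimators $\widehat F_n$ measurable with respect to the sample $(X_i,T_i,\delta_i)_{i=1,\dots,n}$, the supremum is over conditional c.d.f.'s $F$ (i.e. $F(x,\cdot)$ is a c.d.f. of a positive variable for each $x$) whose restriction to $A$ belongs to $\mathcal B^\beta_{2,\infty}(A,L)$, and $\|\cdot\|$ is the $L^2(A)$ norm.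
   Context: Observation model: $(X_i,Y_i,T_i)_{i\le n}$ i.i.d., $Y_i,T_i>0$, $Y_i$ independent of $T_i$ conditionally on $X_i$, $\mathbb P[Y\le y\mid X=x]=F(x,y)$; one observes only $(X_i,T_i,\delta_i)$, $\delta_i=\mathbf 1_{\{Y_i\le T_i\}}$. The distribution of $(X_i,T_i)$ is fixed (it does not vary with $F$). $A=A_1\times A_2\subset\mathbb R\times\mathbb R^+$ is a product of nondegenerate compact intervals. Anisotropic Besov ball: for $f\in L^2(A)$, $j\in\{1,2\}$, $r\in\mathbb N^*$, $h>0$, $\Delta^r_{h,j}f(x,y)=\sum_{k=0}^r\binom rk(-1)^{r-k}f((x,y)+khe_j)$ on $A^r_{h,j}=\{z\in A: z+rhe_j\in A\}$ ($e_1,e_2$ canonical basis of $\mathbb R^2$); $\omega_{r,j}(f,t)=\sup_{|h|\le t}\|\Delta^r_{h,j}f\|_{L^2(A^r_{h,j})}$; with $r_j=\lfloor\beta_j\rfloor+1$, $|f|_{\mathcal B^\beta_{2,\infty}}=\sup_{t>0}[t^{-\beta_1}\omega_{r_1,1}(f,t)+t^{-\beta_2}\omega_{r_2,2}(f,t)]$, $\|f\|_{\mathcal B^\beta_{2,\infty}}=|f|_{\mathcal B^\beta_{2,\infty}}+\|f\|_{L^2(A)}$, and $\mathcal B^\beta_{2,\infty}(A,L)=\{f:\|f\|_{\mathcal B^\beta_{2,\infty}}\le L\}$. *)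

(* Defs.v *)
From HB Require Import structures.
From mathcomp Require Import all_boot all_order all_algebra.
From mathcomp Require Import all_classical all_reals all_analysis.
Set Implicit Arguments. Unset Strict Implicit. Unset Printing Implicit Defensive.
Import Order.TTheory GRing.Theory Num.Theory.
Import numFieldNormedType.Exports.
Local Open Scope classical_set_scope.
Local Open Scope ring_scope.

Section Defs.
Variable R : realType.
Local Notation mu := (@lebesgue_measure R).

Definition L2sq (D1 D2 : set R) (g : R -> R -> R) : \bar R :=
  (\int[mu]_(x in D1) \int[mu]_(y in D2) ((g x y) ^+ 2)%:E)%E.

Definition L2norm (D1 D2 : set R) (g : R -> R -> R) : \bar R :=
  sqrte (L2sq D1 D2 g).

Definition diff1 (r : nat) (h : R) (f : R -> R -> R) : R -> R -> R :=
  fun x y => \sum_(k < r.+1) ('C(r, k)%:R * (-1) ^+ (r - k) * f (x + k%:R * h) y).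
Definition diff2 (r : nat) (h : R) (f : R -> R -> R) : R -> R -> R :=
  fun x y => \sum_(k < r.+1) ('C(r, k)%:R * (-1) ^+ (r - k) * f x (y + k%:R * h)).

(* A^r_{h,j} for the rectangle A = A1 x A2 is again a rectangle *)
Definition shrink (D : set R) (r : nat) (h : R) : set R :=
  [set x | D x /\ D (x + r%:R * h)].

Definition omega1 (A1 A2 : set R) (r : nat) (f : R -> R -> R) (t : R) : \bar R :=
  ereal_sup [set L2norm (shrink A1 r h) A2 (diff1 r h f) | h in [set h : R | `|h| <= t]].
Definition omega2 (A1 A2 : set R) (r : nat) (f : R -> R -> R) (t : R) : \bar R :=
  ereal_sup [set L2norm A1 (shrink A2 r h) (diff2 r h f) | h in [set h : R | `|h| <= t]].

Definition rB (b : R) : nat := (Num.truncn b).+1.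

Definition besov_semi (A1 A2 : set R) (b1 b2 : R) (f : R -> R -> R) : \bar R :=
  ereal_sup [set ((t `^ (- b1))%:E * omega1 A1 A2 (rB b1) f t
                  + (t `^ (- b2))%:E * omega2 A1 A2 (rB b2) f t)%E
            | t in [set t : R | 0 < t]].

Definition besov_norm (A1 A2 : set R) (b1 b2 : R) (f : R -> R -> R) : \bar R :=
  (besov_semi A1 A2 b1 b2 f + L2norm A1 A2 f)%E.

Definition besov_ball (A1 A2 : set R) (b1 b2 L : R) (f : R -> R -> R) : Prop :=
  (besov_norm A1 A2 b1 b2 f <= L%:E)%E.

Definition cond_cdf (F : R -> R -> R) : Prop :=
  (forall y, measurable_fun setT (fun x => F x y)) /\
  forall x, exists P : probability R R,
      P `]0, +oo[%classic = 1%E /\ forall y, (F x y)%:E = P `]-oo, y]%classic.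

Definition design_density (fd : R * R -> R) : Prop :=
  measurable_fun setT fd /\ (forall p, 0 <= fd p) /\
  (forall p, p.2 <= 0 -> fd p = 0) /\
  (\int[mu]_x \int[mu]_t (fd (x, t))%:E = 1)%E.

Definition obs := ((R * R) * bool)%type.

(* integral of g against the law of one observation (X,T,delta) when
   (X,T) has density fd and P[Y <= y | X = x] = F x y, Y indep. of T given X:
   P[delta = 1 | X = x, T = t] = F x t. *)
Definition obsInt (F : R -> R -> R) (fd : R * R -> R) (g : obs -> \bar R) : \bar R :=
  (\int[mu]_x \int[mu]_t ((fd (x, t))%:E *
      ((F x t)%:E * g ((x, t), true) + (1 - F x t)%:E * g ((x, t), false))))%E.

(* sample space of n.+1 observations, with the product sigma-algebra *)
Fixpoint sampleM (n : nat) : {d : measure_display & measurableType d} :=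
  match n with
  | 0 => existT (fun d => measurableType d) _ (obs : measurableType _)
  | k.+1 => existT (fun d => measurableType d) _
              ((obs * projT2 (sampleM k))%type : measurableType _)
  end.

Definition sample (n : nat) := projT2 (sampleM n).

(* expectation under the i.i.d. product law of n.+1 observations
   (iterated integral; equals the product-measure integral by Tonelli) *)
Fixpoint sampleInt (F : R -> R -> R) (fd : R * R -> R) (n : nat) :
    (sample n -> \bar R) -> \bar R :=
  match n return (sample n -> \bar R) -> \bar R with
  | 0 => fun g => obsInt F fd g
  | k.+1 => fun g => obsInt F fd (fun o => sampleInt F fd (fun s => g (o, s)))
  end.

Definition estimator (n : nat) (est : sample n -> R -> R -> R) : Prop :=
  measurable_fun setT (fun p : sample n * (R * R) => est p.1 p.2.1 p.2.2).

(* E[ n^{rate} || Fhat_n - F ||^2_{L^2(A)} ] for a sample of size n >= 1 *)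
Definition risk (A1 A2 : set R) (fd : R * R -> R) (rate : R) (n : nat)
    (est : sample n.-1 -> R -> R -> R) (F : R -> R -> R) : \bar R :=
  sampleInt F fd (fun s => ((n%:R `^ rate)%:E * L2sq A1 A2 (fun x y => (est s x y - F x y)%R))%E).

End Defs.

(* Main.v *)
Require Import Defs.
From HB Require Import structures.
From mathcomp Require Import all_boot all_order all_algebra.
From mathcomp Require Import all_classical all_reals all_analysis.
From mathcomp Require Import measurable_realfun.
From mathcomp Require Import ring lra.
Set Implicit Arguments. Unset Strict Implicit. Unset Printing Implicit Defensive.
Import Order.TTheory GRing.Theory Num.Theory.
Import numFieldNormedType.Exports.
Local Open Scope classical_set_scope.
Local Open Scope ring_scope.

(** Assouad's method. On the upper half of [A], which is cut into [m1 * m2]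
cells, the function [eps * y] is perturbed in each cell by [0] or by
[gam] times a product of two rescaled bumps [(u * (1 - u)) ^+ deg]. With
[gam] of the order of [n `^ (- (rate / 2))] and a cell of sides
[gam `^ (1 / beta1)] and [gam `^ (1 / beta2)], every choice stays in the Besov
ball (finite differences are bounded uniformly, by the mean value theorem) and
stays nondecreasing in [y], because [beta2 > 1].
Flipping the perturbation of one cell changes the law of an observation by a
chi-square distance of order [1 / n], so that the [n]-sample cannot decide
between the two values, and the loss on that cell is at least of order
[gam ^+ 2] times the area of the cell for one of them. Averaging over all the
choices and summing over the cells gives a risk of order [gam ^+ 2].

The two-point bound is proved by induction on the sample size directly on the
iterated integrals, without product measures: with [u] a likelihood ratio, the
estimate [min 1 u >= u - u ^+ 2 / 4] is preserved by integrating out one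
observation, at the price of one chi-square factor. *)

(** * Finite differences *)

(** Freezing one coordinate turns [diff1] and [diff2] into this, term by term. *)
Definition fdiff {R : realType} (r : nat) (h : R) (f : R -> R) (x : R) : R :=
  \sum_(k < r.+1) ('C(r, k)%:R * (-1) ^+ (r - k) * f (x + k%:R * h)).

Section FiniteDifferences.
Variable R : realType.
Implicit Types (r : nat) (h x M : R) (f g df : R -> R).

Lemma fdiff0 h f x : fdiff 0 h f x = f x.
Proof. by rewrite /fdiff big_ord1 bin0 subnn expr0 !mul1r mul0r addr0. Qed.

(** Pascal's rule. This recursion carries the inductions on the order. *)
Lemma fdiffS r h f x : fdiff r.+1 h f x = fdiff r h f (x + h) - fdiff r h f x.
Proof.
rewrite {1}/fdiff big_ord_recl.
under eq_bigr => k _.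
  rewrite lift0 subSS binS natrD 2!mulrDl.
  have -> : x + k.+1%:R * h = x + h + k%:R * h by rewrite -natr1; ring.
  over.
rewrite big_split/= addrA addrC -/(fdiff r h f (x + h)); congr (_ + _).
rewrite /fdiff [in RHS]big_ord_recl big_ord_recr/= (@bin_small r r.+1)// !mul0r !addr0.
rewrite !bin0 !subn0 opprD; congr (_ + _); first by rewrite exprS; ring.
rewrite -sumrN; apply: eq_bigr => /= k _.
rewrite /bump leq0n add1n -[(r - k)%N]prednK ?subn_gt0//= -subnS exprS.
have -> : x + h + k%:R * h = x + k.+1%:R * h by rewrite -natr1; ring.
by ring.
Qed.

Lemma fdiffD r h f g x :
  fdiff r h (fun t => f t + g t) x = fdiff r h f x + fdiff r h g x.
Proof. by rewrite /fdiff -big_split/=; apply: eq_bigr => k _; rewrite mulrDr. Qed.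

Lemma fdiff_bounded r h f M : (forall t, `|f t| <= M) ->
  forall x, `|fdiff r h f x| <= 2 ^+ r * M.
Proof.
move=> fM; elim: r => [|r IH] x; first by rewrite fdiff0 expr0 mul1r.
rewrite fdiffS (le_trans (ler_normB _ _))// exprS -mulrA mulr_natl mulr2n.
by rewrite lerD.
Qed.

Lemma is_derive_fdiff r h f df : (forall t : R, is_derive t (1 : R) f (df t)) ->
  forall x : R, is_derive x (1 : R) (fdiff r h f) (fdiff r h df x).
Proof.
move=> fdf; elim: r => [|r IH] x.
  rewrite fdiff0; have -> : fdiff 0 h f = f by apply/funext => t; rewrite fdiff0.
  exact: fdf.
have -> : fdiff r.+1 h f = (fdiff r h f \o shift h) - fdiff r h f.
  by apply/funext => t; rewrite fdiffS.
rewrite fdiffS; apply: is_deriveB; rewrite -[X in is_derive _ _ _ X]mulr1.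
apply: is_derive1_comp; exact: is_derive_shift.
Qed.

Lemma derive_bounded_lipschitz f df M : (forall t : R, is_derive t (1 : R) f (df t)) ->
  (forall t, `|df t| <= M) -> forall x y, `|f y - f x| <= `|y - x| * M.
Proof.
move=> fdf dfM.
suff lip x y : x <= y -> `|f y - f x| <= `|y - x| * M.
  move=> x y; have [/lip//|/ltW /lip] := leP x y.
  by rewrite distrC [in X in _ -> X]distrC => H; rewrite distrC [`|y - x|]distrC.
move=> xy; have [//|c _ ->] := MVT_segment xy (fun t _ => fdf t).
  apply: derivable_within_continuous => t _; exact: ex_derive.
by rewrite normrM mulrC ler_wpM2l.
Qed.

(** The successive derivatives come as a family, so that the induction hypothesis applies to the
    shifted family. A difference of order [r.+1] is an increment of the one of order [r], whose
    derivative is [fdiff r h (f 1)]; the mean value theorem supplies one more factor [|h|]. *)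
Lemma fdiff_derive_bounded r h (f : nat -> R -> R) M :
  (forall k, (k < r)%N -> forall t : R, is_derive t (1 : R) (f k) (f k.+1 t)) ->
  (forall t, `|f r t| <= M) ->
  forall x, `|fdiff r h (f 0) x| <= `|h| ^+ r * M.
Proof.
elim: r f => [|r IH] f fD fM x; first by rewrite fdiff0 expr0 mul1r.
have dfd := @is_derive_fdiff r h (f 0) (f 1) (fD 0 isT).
have bfd := IH (fun k => f k.+1) (fun k kr => fD k.+1 kr) fM.
rewrite fdiffS; apply: le_trans (derive_bounded_lipschitz dfd bfd _ _) _.
by rewrite [x + h]addrC addrK mulrA -exprS.
Qed.

End FiniteDifferences.

(** * Polynomial bumps and their rescaled superpositions *)

Section CutPolynomials.
Variable R : realType.
Implicit Types (p q : {poly R}) (u v x : R).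

(* Polynomial pieces glued to zero outside the unit interval. *)
Definition cut p u : R := if 0 < u < 1 then p.[u] else 0.

Definition bumpX : {poly R} := 'X * (1 - 'X).

Lemma bumpXE u : bumpX.[u] = u * (1 - u).
Proof. by rewrite /bumpX !hornerE. Qed.

Lemma poly_bounded p : exists2 M, 0 <= M & forall u, 0 < u < 1 -> `|p.[u]| <= M.
Proof.
exists (\sum_(i < size p) `|p`_i|); first exact: sumr_ge0.
move=> u /andP[u0 u1]; rewrite horner_coef (le_trans (ler_norm_sum _ _ _))//.
apply: ler_sum => i _; rewrite normrM ler_piMr// normrX exprn_ile1//.
  by rewrite ger0_norm// ltW.
Qed.

Lemma cut_bounded p : exists2 M, 0 <= M & forall u, `|cut p u| <= M.
Proof.
have [M M0 pM] := poly_bounded p; exists M => // u; rewrite /cut.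
by case: ifPn => [/pM//|_]; rewrite normr0.
Qed.

(** The difference quotient at [u] is of the order of its step. This serves at the junctions 0 and 1
    of [cut]. *)
Lemma is_derive_quadratic_contact (f : R -> R) u M :
  (forall v, `|f v - f u| <= M * (v - u) ^+ 2) -> is_derive u (1 : R) f 0.
Proof.
move=> fM.
suff H : h^-1 *: (f (h *: 1 + u) - f u) @[h --> 0^'] --> (0 : R).
  by apply: DeriveDef; [apply/cvg_ex; exists 0|exact/cvg_lim].
apply/cvgr0Pnorm_le => e e0; near=> h.
have h0 : h != 0 by near: h; exact: nbhs_dnbhs_neq.
rewrite normrZ normfV ler_pdivrMl ?normr_gt0//.
rewrite (le_trans (fM _))// addrK scaler1 -real_normK ?num_real// expr2 mulrA.
(* The added 1 makes the factor positive, so that one can divide by it. *)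
rewrite [leRHS]mulrC ler_wpM2r// (@le_trans _ _ ((`|M| + 1) * `|h|))//.
  by rewrite ler_wpM2r// (le_trans (ler_norm _))// lerDl.
rewrite -ler_pdivlMl ?ltr_wpDl//.
near: h; apply: dnbhs0_le; rewrite mulr_gt0// invr_gt0 ltr_wpDl//.
Unshelve. all: by end_near. Qed.

(** The double zeros of [p] at 0 and 1 make its contact with the zero function quadratic, so that
    the glued function has derivative 0 there; elsewhere it agrees locally with [p] or with 0. *)
Lemma is_derive_cut p u : bumpX ^+ 2 %| p -> is_derive u (1 : R) (cut p) (cut p^`() u).
Proof.
move=> /dvdpP [q pE].
have contact (w : R) : w = 0 \/ w = 1 -> is_derive w (1 : R) (cut p) 0.
  move=> w01; have [M M0 qM] := poly_bounded q.
  apply: (@is_derive_quadratic_contact _ _ M) => v.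
  have -> : cut p w = 0 by rewrite /cut; case: w01 => ->; rewrite ltxx ?andbF.
  rewrite subr0 /cut; case: ifPn => v01; last by rewrite normr0 mulr_ge0// sqr_ge0.
  rewrite pE hornerM horner_exp bumpXE normrM ler_pM ?qM//.
  case/andP: v01 => v0 v1; rewrite ger0_norm ?sqr_ge0// -[leRHS]real_normK ?num_real//.
  rewrite lerXn2r ?nnegrE ?mulr_ge0 ?subr_ge0 ?(ltW v0) ?(ltW v1)//.
  case: w01 => ->; rewrite ?subr0.
    by rewrite ger0_norm ?(ltW v0)// ler_piMr ?(ltW v0)// gerBl (ltW v0).
  by rewrite distrC ger0_norm ?subr_ge0 ?(ltW v1)// ler_piMl ?subr_ge0 ?(ltW v1).
have [u0|u0|->] := ltgtP u 0.
- rewrite /cut (lt_gtF u0)/=; apply: (@near_eq_is_derive _ _ _ (cst 0)).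
  by near=> v; rewrite lt_gtF//; near: v; exact: lt_nbhsl.
- have [u1|u1|->] := ltgtP u 1.
  + rewrite {2}/cut u0 u1/=; apply: (@near_eq_is_derive _ _ _ (horner p)).
      near=> v; rewrite /cut.
      have -> : 0 < v by near: v; exact: lt_nbhsr.
      suff -> : v < 1 by [].
      by near: v; exact: lt_nbhsl.
  + rewrite {2}/cut u0 (lt_gtF u1)/=; apply: (@near_eq_is_derive _ _ _ (cst 0)).
      near=> v; rewrite /cut.
      suff -> : v < 1 = false by rewrite andbF.
      by apply: lt_gtF; near: v; exact: lt_nbhsr.
  + by rewrite {2}/cut ltxx andbF; apply: contact; right.
- by rewrite {2}/cut ltxx; apply: contact; left.
Unshelve. all: by end_near. Qed.

(** Each differentiation costs one factor [bumpX], so that a high power can be differentiated many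
    times before [is_derive_cut] fails to apply. *)
Lemma bumpX_dvd_derivn m k : (k <= m)%N -> bumpX ^+ (m - k) %| (bumpX ^+ m)^`(k).
Proof.
elim: k => [_|k IH km]; first by rewrite subn0 derivn0.
have /dvdpP[q qE] := IH (ltnW km).
rewrite derivnS qE derivM deriv_exp.
have -> : (m - k)%N = (m - k.+1).+1 by rewrite subnSK.
apply: dvdp_add.
  by rewrite exprS mulrA; apply: dvdp_mull.
by rewrite /= mulrnAr mulrA -mulr_natl; do 2!apply: dvdp_mull.
Qed.

(** Copies of [cut p] on the consecutive intervals of length [w] starting at [x0], with amplitudes
    [c]. At most one term is nonzero at each point, so that sup bounds do not grow with [n]. *)
Definition wave p (x0 w : R) n (c : 'I_n -> R) x : R :=
  \sum_(j < n) c j * cut p ((x - x0) / w - j%:R).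

Lemma cut_shift_eq0 p v i j : 0 < v - i%:R < 1 -> j != i -> cut p (v - j%:R) = 0.
Proof.
move=> /andP[v0 v1] ji; rewrite /cut; case: ifPn => // /andP[w0 w1].
have /eqP : j = i; last by rewrite (negbTE ji).
have : j%:R < i%:R + 1 :> R by lra.
have : i%:R < j%:R + 1 :> R by lra.
by rewrite !natr1 !ltr_nat !ltnS => ij jI; apply/eqP; rewrite eqn_leq jI ij.
Qed.

Lemma wave_in_cell p (x0 w : R) n (c : 'I_n -> R) x (i : 'I_n) : 0 < (x - x0) / w - i%:R < 1 ->
  wave p x0 w c x = c i * p.[(x - x0) / w - i%:R].
Proof.
move=> xi; rewrite /wave (bigD1 i)//= big1 ?addr0.
  by rewrite /cut xi.
by move=> j ji; rewrite (cut_shift_eq0 _ xi) ?mulr0.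
Qed.

Lemma wave_off_cells p (x0 w : R) n (c : 'I_n -> R) x :
  (forall i : 'I_n, ~~ (0 < (x - x0) / w - i%:R < 1)) -> wave p x0 w c x = 0.
Proof.
by move=> xi; rewrite /wave big1// => i _; rewrite /cut (negbTE (xi i)) mulr0.
Qed.

Lemma wave_cellP p (x0 w : R) n (c : 'I_n -> R) x :
  wave p x0 w c x = 0 \/
  exists2 i : 'I_n, 0 < (x - x0) / w - i%:R < 1 &
    wave p x0 w c x = c i * p.[(x - x0) / w - i%:R].
Proof.
have [[i xi]|xN] := pselect (exists i : 'I_n, 0 < (x - x0) / w - i%:R < 1).
  by right; exists i => //; exact: wave_in_cell.
by left; apply: wave_off_cells => i; apply/negP => xi; apply: xN; exists i.
Qed.

Lemma wave_bounded p (x0 w : R) n (c : 'I_n -> R) M :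
  (forall u, `|cut p u| <= M) -> (forall i, `|c i| <= 1) ->
  forall x, `|wave p x0 w c x| <= M.
Proof.
move=> pM c1 x; have M0 : 0 <= M by exact: le_trans (pM 0).
have [->|[i xi ->]] := wave_cellP p x0 w c x; first by rewrite normr0.
have := pM ((x - x0) / w - i%:R); rewrite /cut xi normrM; apply: le_trans.
by rewrite ler_piMl.
Qed.

Lemma is_derive_wave p (x0 w : R) n (c : 'I_n -> R) x : bumpX ^+ 2 %| p ->
  is_derive x (1 : R) (wave p x0 w c) (w^-1 * wave p^`() x0 w c x).
Proof.
move=> pW.
have -> : wave p x0 w c =
    \sum_(j < n) (c j \*: (cut p \o (fun t => (t - x0) / w - j%:R))).
  by apply/funext => t; rewrite fct_sumE.
rewrite /wave mulr_sumr; apply: is_derive_sum => j.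
rewrite mulrCA; apply: is_deriveZ; rewrite mulrC.
apply: is_derive1_comp; first exact: is_derive_cut.
have -> : (fun t : R => (t - x0) / w - j%:R) =
    (w^-1 \*: shift (- x0)) - cst j%:R.
  by apply/funext => t; rewrite mulrC.
have : is_derive x (1 : R) ((w^-1 \*: shift (- x0)) - cst j%:R : R -> R)
    (w^-1 *: (1 : R) - 0).
  by apply: is_deriveB; apply: is_deriveZ; exact: is_derive_shift.
by rewrite subr0 [_ *: _]mulr1.
Qed.

Lemma wave_derivn_chain m (x0 w : R) n (c : 'I_n -> R) k : (k.+1 < m)%N -> forall x : R,
  is_derive x (1 : R) (fun t => w^-1 ^+ k * wave (bumpX ^+ m)^`(k) x0 w c t)
    (w^-1 ^+ k.+1 * wave (bumpX ^+ m)^`(k.+1) x0 w c x).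
Proof.
move=> km x; rewrite exprSr -mulrA derivnS.
apply: is_deriveZ; apply: is_derive_wave.
(* As [k + 2 <= m], the derivative of order [k] keeps the square factor that [is_derive_cut]
   requires. *)
apply: dvdp_trans (bumpX_dvd_derivn (ltnW (ltnW km))).
by apply: dvdp_exp2l; rewrite -addn2 leq_subRL ?addn2 // ltnW // ltnW.
Qed.

(** One constant serves all orders: the derivatives vanish beyond the degree, and finitely many
    orders remain. *)
Lemma bumpX_derivn_bounded m : exists2 M : R, 1 <= M &
  forall k u, `|cut (bumpX ^+ m)^`(k) u| <= M.
Proof.
suff H n : exists2 M : R, 1 <= M &
  forall k, (k < n)%N -> forall u, `|cut (bumpX ^+ m)^`(k) u| <= M.
  have [M M1 kM] := H (size (bumpX ^+ m : {poly R})).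
  exists M => // k u; have [/kM//|sk] := ltnP k (size (bumpX ^+ m : {poly R})).
  rewrite derivn_poly0// /cut horner0 if_same normr0.
  exact: le_trans M1.
elim: n => [|n [M M1 IH]]; first by exists 1.
have [N N0 bN] := cut_bounded (bumpX ^+ m)^`(n).
exists (M + N) => [|k]; first by rewrite ler_wpDr.
rewrite ltnS leq_eqVlt => /orP[/eqP -> u|/IH kM u].
  by rewrite (le_trans (bN u))// lerDr (le_trans _ M1).
by rewrite (le_trans (kM u))// lerDl.
Qed.

(** Each derivative brings a factor [w^-1] by the chain rule and a factor [|h|] by the mean value
    theorem; disjoint supports make the bound independent of the number of cells. *)
Lemma fdiff_wave_small m r h (x0 w : R) n (c : 'I_n -> R) M : (r < m)%N -> 0 < w ->
  (forall i, `|c i| <= 1) ->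
  (forall k u, `|cut (bumpX ^+ m)^`(k) u| <= M) ->
  forall x, `|fdiff r h (wave (bumpX ^+ m) x0 w c) x| <= (`|h| / w) ^+ r * M.
Proof.
move=> rm w0 c1 kM x.
pose f k t := w^-1 ^+ k * wave (bumpX ^+ m)^`(k) x0 w c t.
have -> : wave (bumpX ^+ m) x0 w c = f 0.
  by apply/funext => t; rewrite /f expr0 mul1r derivn0.
rewrite exprMn -mulrA; apply: fdiff_derive_bounded => [k kr t|t].
  by apply: wave_derivn_chain; exact: leq_ltn_trans rm.
rewrite /f normrM normrX ger0_norm ?invr_ge0 ?(ltW w0)//.
by rewrite ler_wpM2l ?exprn_ge0 ?invr_ge0 ?(ltW w0)//; exact: wave_bounded.
Qed.

End CutPolynomials.

(** * Integration against the law of the sample *)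

Section IntegralMonotonicity.
Context d (T : measurableType d) (R : realType).
Variable mu : {measure set T -> \bar R}.
Local Open Scope ereal_scope.

(* Contrary to [ge0_le_integral], no measurability is required. *)
Lemma ge0_le_integral_dom (D A : set T) (f g : T -> \bar R) : D `<=` A ->
  (forall x, D x -> 0 <= f x) -> (forall x, A x -> 0 <= g x) ->
  (forall x, D x -> f x <= g x) ->
  \int[mu]_(x in D) f x <= \int[mu]_(x in A) g x.
Proof.
(* Both integrals are suprema over the simple functions below the integrand, and those below [f] are
   below [g]. *)
move=> DA f0 g0 fg; rewrite !ge0_integralE//; apply: le_ereal_sup => _ [h hf <-].
exists h => // x; apply: (le_trans (hf x)); rewrite /patch.
case: ifPn => [|_].
  by rewrite inE => Dx; rewrite mem_set; [exact: fg|exact: DA].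
by case: ifPn; rewrite // inE => /g0.
Qed.

End IntegralMonotonicity.

Section ObservationIntegral.
Context {R : realType} (F : R -> R -> R) (fd : R * R -> R).
Hypothesis mF : measurable_fun setT (fun p : R * R => F p.1 p.2).
Hypothesis F01 : forall x t, 0 <= F x t <= 1.
Hypothesis mfd : measurable_fun setT fd.
Hypothesis fd0 : forall p, 0 <= fd p.
Local Notation mu := (@lebesgue_measure R).
Local Open Scope ereal_scope.
Local Notation obs := ((R * R) * bool)%type.
Implicit Types (g : obs -> \bar R).

Let integrand g (p : R * R) : \bar R :=
  (fd p)%:E * ((F p.1 p.2)%:E * g (p, true) + (1 - F p.1 p.2)%:E * g (p, false)).

Let obsIntE g : obsInt F fd g = \int[mu]_x \int[mu]_t integrand g (x, t).
Proof. by []. Qed.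

Let F_ge0 x t : 0 <= (F x t)%:E.
Proof. by rewrite lee_fin; case/andP: (F01 x t). Qed.

Let Fc_ge0 x t : 0 <= (1 - F x t)%:E.
Proof. by rewrite lee_fin subr_ge0; case/andP: (F01 x t). Qed.

Let integrand_ge0 g p : (forall o, 0 <= g o) -> 0 <= integrand g p.
Proof.
by move=> g0; rewrite /integrand mule_ge0 ?lee_fin// adde_ge0// mule_ge0.
Qed.

Let measurable_integrand d (T : measurableType d) (G : T * obs -> \bar R) :
  measurable_fun setT G ->
  measurable_fun setT (fun q : T * (R * R) => integrand (fun o => G (q.1, o)) q.2).
Proof.
move=> mG; apply: emeasurable_funM.
  by apply/measurable_EFinP; apply: measurableT_comp.
have mFq : measurable_fun setT (fun q : T * (R * R) => F q.2.1 q.2.2).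
  by apply: (measurableT_comp mF); exact: measurable_snd.
have mGb b : measurable_fun setT (fun q : T * (R * R) => G (q.1, (q.2, b))).
  apply: (measurableT_comp mG); apply: measurable_fun_pair => //.
  by apply: measurable_fun_pair.
apply: emeasurable_funD; apply: emeasurable_funM => //; apply/measurable_EFinP => //.
exact: measurable_funB.
Qed.

Lemma obsInt_ge0 g : (forall o, 0 <= g o) -> 0 <= obsInt F fd g.
Proof.
move=> g0; rewrite obsIntE; apply: integral_ge0 => x _.
by apply: integral_ge0 => t _; exact: integrand_ge0.
Qed.

Lemma le_obsInt g1 g2 : (forall o, 0 <= g1 o) -> (forall o, g1 o <= g2 o) ->
  obsInt F fd g1 <= obsInt F fd g2.
Proof.
move=> g0 g12; have g20 o : 0 <= g2 o by exact: le_trans (g12 o).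
rewrite !obsIntE; apply: ge0_le_integral_dom => // [x _|x _|x _].
- by apply: integral_ge0 => t _; exact: integrand_ge0.
- by apply: integral_ge0 => t _; exact: integrand_ge0.
- apply: ge0_le_integral_dom => // t _; rewrite ?integrand_ge0//.
  by rewrite lee_wpmul2l ?lee_fin// leeD// lee_wpmul2l.
Qed.

(** Tonelli's theorem with a parameter, once for each real variable; the grouping [(T * R) * R] lets
    every integration remove the last coordinate. *)
Lemma measurable_obsInt d (T : measurableType d) (G : T * obs -> \bar R) :
  measurable_fun setT G -> (forall q, 0 <= G q) ->
  measurable_fun setT (fun z => obsInt F fd (fun o => G (z, o))).
Proof.
move=> mG G0.
pose H (q : (T * R) * R) := integrand (fun o => G (q.1.1, o)) (q.1.2, q.2).
have mH : measurable_fun setT H.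
  have mc : measurable_fun setT (fun q : (T * R) * R => (q.1.1, (q.1.2, q.2))).
    by repeat apply: measurable_fun_pair => //; apply: measurableT_comp.
  exact: (measurableT_comp (measurable_integrand mG) mc).
have mI := measurable_fun_fubini_tonelli_F (m2 := mu) H mH
  (fun q => integrand_ge0 _ (fun o => G0 _)).
apply: (measurable_fun_fubini_tonelli_F (m2 := mu) _ mI) => q.
by apply: integral_ge0 => t _; apply: integrand_ge0.
Qed.

Let measurable_integrand1 g : measurable_fun setT g ->
  measurable_fun setT (integrand g).
Proof.
move=> mg.
have mG : measurable_fun setT (fun q : R * obs => g q.2).
  exact: measurableT_comp.
have mc : measurable_fun setT (fun p : R * R => (0%R : R, p)).
  exact: measurable_fun_pair.
exact: (measurableT_comp (measurable_integrand mG) mc).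
Qed.

Let measurable_inner g : measurable_fun setT g -> (forall o, 0 <= g o) ->
  measurable_fun setT (fun x => \int[mu]_t integrand g (x, t)).
Proof.
move=> mg g0; apply: (measurable_fun_fubini_tonelli_F (m2 := mu) (integrand g)).
  exact: measurable_integrand1.
by move=> p; exact: integrand_ge0.
Qed.

Lemma obsIntD g1 g2 : measurable_fun setT g1 -> measurable_fun setT g2 ->
  (forall o, 0 <= g1 o) -> (forall o, 0 <= g2 o) ->
  obsInt F fd (fun o => g1 o + g2 o) = obsInt F fd g1 + obsInt F fd g2.
Proof.
move=> m1 m2 p1 p2; rewrite !obsIntE -ge0_integralD//; first last.
- exact: measurable_inner.
- by move=> x _; apply: integral_ge0 => t _; exact: integrand_ge0.
- exact: measurable_inner.
- by move=> x _; apply: integral_ge0 => t _; exact: integrand_ge0.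
apply: eq_integral => x _; rewrite -ge0_integralD//; first last.
- by apply: measurable_fun_pair2; exact: measurable_integrand1.
- by move=> t _; exact: integrand_ge0.
- by apply: measurable_fun_pair2; exact: measurable_integrand1.
- by move=> t _; exact: integrand_ge0.
apply: eq_integral => t _; rewrite /integrand -ge0_muleDr ?adde_ge0 ?mule_ge0//.
by congr (_ * _); rewrite !ge0_muleDr// addeACA.
Qed.

Lemma obsIntZ (k : R) g : measurable_fun setT g -> (forall o, 0 <= g o) ->
  (0 <= k)%R -> obsInt F fd (fun o => k%:E * g o) = k%:E * obsInt F fd g.
Proof.
move=> mg g0 k0; rewrite !obsIntE -ge0_integralZl_EFin//; first last.
- exact: measurable_inner.
- by move=> x _; apply: integral_ge0 => t _; exact: integrand_ge0.
apply: eq_integral => x _; rewrite -ge0_integralZl_EFin//; first last.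
- by apply: measurable_fun_pair2; exact: measurable_integrand1.
- by move=> t _; exact: integrand_ge0.
apply: eq_integral => t _; rewrite /integrand [RHS]muleCA; congr (_ * _).
by rewrite ge0_muleDr ?mule_ge0//; congr (_ + _); rewrite muleCA.
Qed.

Lemma sampleInt_ge0 n (g : sample R n -> \bar R) : (forall s, 0 <= g s) ->
  0 <= sampleInt F fd g.
Proof.
elim: n g => [|n IH] g g0 /=; apply: obsInt_ge0 => // o.
by apply: IH => s; exact: g0.
Qed.

Lemma le_sampleInt n (g1 g2 : sample R n -> \bar R) : (forall s, 0 <= g1 s) ->
  (forall s, g1 s <= g2 s) -> sampleInt F fd g1 <= sampleInt F fd g2.
Proof.
elim: n g1 g2 => [|n IH] g1 g2 g0 g12 /=; apply: le_obsInt => // o.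
- by apply: sampleInt_ge0 => s; exact: g0.
- by apply: IH => s; [exact: g0|exact: g12].
Qed.

(** The parameter space is arbitrary because the induction moves the first observation into it. *)
Lemma measurable_sampleInt n d (T : measurableType d)
    (G : T * sample R n -> \bar R) :
  measurable_fun setT G -> (forall q, 0 <= G q) ->
  measurable_fun setT (fun z => sampleInt F fd (fun s => G (z, s))).
Proof.
elim: n d T G => [|n IH] d T G mG G0 /=; first exact: measurable_obsInt.
apply: (measurable_obsInt
  (G := fun q : T * obs => sampleInt F fd (fun s => G (q.1, (q.2, s))))).
  apply: (IH _ _ (fun p : (T * obs) * sample R n => G (p.1.1, (p.1.2, p.2)))).
    apply: (measurableT_comp mG).
    by repeat apply: measurable_fun_pair => //; apply: measurableT_comp.
  by move=> q; exact: G0.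
by move=> q; apply: sampleInt_ge0 => s; exact: G0.
Qed.

Lemma measurable_sampleInt_slice n (g : sample R n.+1 -> \bar R) :
  measurable_fun setT g -> (forall s, 0 <= g s) ->
  measurable_fun setT (fun o : obs => sampleInt F fd (fun s => g (o, s))).
Proof. by move=> mg g0; exact: measurable_sampleInt. Qed.

Lemma sampleIntD n (g1 g2 : sample R n -> \bar R) :
  measurable_fun setT g1 -> measurable_fun setT g2 ->
  (forall s, 0 <= g1 s) -> (forall s, 0 <= g2 s) ->
  sampleInt F fd (fun s => g1 s + g2 s) = sampleInt F fd g1 + sampleInt F fd g2.
Proof.
elim: n g1 g2 => [|n IH] g1 g2 m1 m2 p1 p2 /=; first exact: obsIntD.
rewrite -obsIntD; first last.
- by move=> o; apply: sampleInt_ge0 => s; exact: p2.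
- by move=> o; apply: sampleInt_ge0 => s; exact: p1.
- exact: measurable_sampleInt_slice.
- exact: measurable_sampleInt_slice.
congr (obsInt _ _ _); apply/funext => o.
by apply: IH => [||s|s]; [exact: measurable_fun_pair2..|exact: p1|exact: p2].
Qed.

Lemma sampleIntZ n (k : R) (g : sample R n -> \bar R) :
  measurable_fun setT g -> (forall s, 0 <= g s) -> (0 <= k)%R ->
  sampleInt F fd (fun s => k%:E * g s) = k%:E * sampleInt F fd g.
Proof.
elim: n g => [|n IH] g mg g0 k0 /=; first exact: obsIntZ.
rewrite -obsIntZ//; first last.
- by move=> o; apply: sampleInt_ge0 => s; exact: g0.
- exact: measurable_sampleInt_slice.
congr (obsInt _ _ _); apply/funext => o.
by apply: IH => //; exact: measurable_fun_pair2.
Qed.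

Lemma sampleInt_sum n (I : Type) (r : seq I) (g : I -> sample R n -> \bar R) :
  (forall i, measurable_fun setT (g i)) -> (forall i s, 0 <= g i s) ->
  \sum_(i <- r) sampleInt F fd (g i) <=
  sampleInt F fd (fun s => \sum_(i <- r) g i s).
Proof.
move=> mg g0; elim: r => [|i r IH].
  by rewrite big_nil; apply: sampleInt_ge0 => s; rewrite big_nil.
have -> : (fun s => \sum_(j <- i :: r) g j s) =
    (fun s => g i s + \sum_(j <- r) g j s).
  by apply/funext => s; rewrite big_cons.
rewrite big_cons sampleIntD//; first by rewrite leeD2l.
- exact: emeasurable_sum.
- by move=> s; exact: sume_ge0.
Qed.

End ObservationIntegral.

(** * Two hypotheses *)

Section TwoPoints.
Context {R : realType} (F F' : R -> R -> R) (fd : R * R -> R).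
Hypothesis mF : measurable_fun setT (fun p : R * R => F p.1 p.2).
Hypothesis F01 : forall x t, 0 <= F x t <= 1.
Hypothesis mF' : measurable_fun setT (fun p : R * R => F' p.1 p.2).
Hypothesis F'01 : forall x t, 0 <= F' x t <= 1.
Hypothesis fd_density : design_density fd.
Variable h1 : R.
Hypothesis fd_le : forall p, fd p <= h1.
Variables (D1 D2 : set R) (v1 v2 kappa delta : R).
Hypothesis mD1 : measurable D1.
Hypothesis mD2 : measurable D2.
Hypothesis kappa0 : 0 < kappa.
Hypothesis F_off : forall x t, ~ (D1 x /\ D2 t) -> F' x t = F x t.
Hypothesis F_on : forall x t, D1 x -> D2 t -> kappa <= F x t * (1 - F x t).
Hypothesis F_close : forall x t, D1 x -> D2 t -> `|F' x t - F x t| <= delta.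
Local Notation mu := (@lebesgue_measure R).
Hypothesis D1_mass : mu D1 = v1%:E.
Hypothesis D2_mass : mu D2 = v2%:E.
Local Open Scope ereal_scope.
Local Notation obs := ((R * R) * bool)%type.

Let mfd : measurable_fun setT fd. Proof. by case: fd_density. Qed.
Let fd0 p : (0 <= fd p)%R. Proof. by case: fd_density => _ []. Qed.
Let fd1 : \int[mu]_x \int[mu]_t (fd (x, t))%:E = 1.
Proof. by case: fd_density => _ [_ []]. Qed.
Let h1_ge0 : (0 <= h1)%R.
Proof. exact: le_trans (fd0 (0, 0)%R) (fd_le _). Qed.

(* Division by zero gives [0], so the ratio is [1] wherever [F' = F]. *)
Definition lik_ratio (o : obs) : R :=
  (if o.2 then 1 + (F' o.1.1 o.1.2 - F o.1.1 o.1.2) / F o.1.1 o.1.2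
  else 1 - (F' o.1.1 o.1.2 - F o.1.1 o.1.2) / (1 - F o.1.1 o.1.2))%R.

Let F_pos x t : D1 x -> D2 t -> (0 < F x t)%R /\ (0 < 1 - F x t)%R.
Proof.
move=> xD tD; have p := lt_le_trans kappa0 (F_on xD tD); have /andP[f0 f1] := F01 x t.
split; rewrite lt_def ?subr_ge0 ?f0 ?f1 andbT.
  by apply: contraTneq p => ->; rewrite mul0r ltxx.
by apply: contraTneq p => ->; rewrite mulr0 ltxx.
Qed.

Let ratio_true x t : (F x t * lik_ratio ((x, t), true) = F' x t)%R.
Proof.
rewrite /lik_ratio/=; have [[xD tD]|/F_off ->] := pselect (D1 x /\ D2 t).
  by have [p _] := F_pos xD tD; field; rewrite gt_eqF.
by rewrite subrr mul0r addr0 mulr1.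
Qed.

Let ratio_false x t : ((1 - F x t) * lik_ratio ((x, t), false) = 1 - F' x t)%R.
Proof.
rewrite /lik_ratio/=; have [[xD tD]|/F_off ->] := pselect (D1 x /\ D2 t).
  by have [_ p] := F_pos xD tD; field; rewrite gt_eqF.
by rewrite subrr mul0r subr0 mulr1.
Qed.

Let ratio_ge0 o : (0 <= lik_ratio o)%R.
Proof.
case: o => -[x t] b.
have [[xD tD]|xtD] := pselect (D1 x /\ D2 t); last first.
  by rewrite /lik_ratio/= (F_off xtD) subrr !mul0r addr0 subr0; case: b.
have [p q] := F_pos xD tD; have /andP[f0 f1] := F'01 x t; case: b.
  by rewrite -(pmulr_rge0 _ p) ratio_true.
by rewrite -(pmulr_rge0 _ q) ratio_false subr_ge0.
Qed.

Let measurable_ratio : measurable_fun setT lik_ratio.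
Proof.
have mFo : measurable_fun setT (fun o : obs => F o.1.1 o.1.2).
  by apply: (measurableT_comp mF); exact: measurable_fst.
have mF'o : measurable_fun setT (fun o : obs => F' o.1.1 o.1.2).
  by apply: (measurableT_comp mF'); exact: measurable_fst.
have mV (f : obs -> R) : measurable_fun setT f -> (forall o, 0 <= f o)%R ->
    measurable_fun setT (fun o => (f o)^-1%R).
  (* On nonnegative values, 0 included, the total inverse is the power of exponent [-1], which is
     known to be measurable. *)
  move=> mf f0; have -> : (fun o => (f o)^-1)%R = (fun o => f o `^ (-1))%R.
    by apply/funext => o; rewrite powR_inv1.
  exact: (measurableT_comp (measurable_powR (-1)%R) mf).
apply: measurable_fun_ifT; first exact: measurable_snd.
- apply: measurable_funD => //; apply: measurable_funM; first exact: measurable_funB.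
  by apply: mV => // o; have /andP[] := F01 o.1.1 o.1.2.
- apply: measurable_funB => //; apply: measurable_funM; first exact: measurable_funB.
  apply: mV => [|o]; first exact: measurable_funB.
  by rewrite subr_ge0; have /andP[] := F01 o.1.1 o.1.2.
Qed.

(** Change of measure: [lik_ratio] is the density of the law under [F'] with respect to the law
    under [F]. *)
Lemma obsInt_ratio (g : obs -> \bar R) :
  obsInt F fd (fun o => (lik_ratio o)%:E * g o) = obsInt F' fd g.
Proof.
rewrite /obsInt; apply: eq_integral => x _; apply: eq_integral => t _.
by rewrite !muleA -!EFinM ratio_true ratio_false.
Qed.

Lemma obsInt_cst1 : obsInt F' fd (fun=> 1) = 1.
Proof.
rewrite -[RHS]fd1 /obsInt; apply: eq_integral => x _; apply: eq_integral => t _.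
by rewrite !mule1 -EFinD addrC subrK mule1.
Qed.

(** Bounds 1 plus the chi-square divergence for one observation: design density at most [h1], area
    [v1 * v2], squared difference at most [delta ^+ 2], Bernoulli variance at least [kappa]. *)
Let kap := (1 + h1 * delta ^+ 2 / kappa * v1 * v2)%R.

(** Given the design point, the chi-square divergence of the two Bernoulli laws is
    [(F' - F) ^+ 2 / (F * (1 - F))]; off [D1] and [D2] the ratio is 1. *)
Let ratio_sqr_le x t : (F x t * lik_ratio ((x, t), true) ^+ 2 +
    (1 - F x t) * lik_ratio ((x, t), false) ^+ 2 <=
  1 + delta ^+ 2 / kappa * (\1_D1 x * \1_D2 t))%R.
Proof.
have [[xD tD]|xtD] := pselect (D1 x /\ D2 t); last first.
  rewrite /lik_ratio/= (F_off xtD) subrr !mul0r addr0 subr0 expr1n !mulr1.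
  rewrite addrC subrK lerDl; apply: mulr_ge0.
    by rewrite divr_ge0 ?sqr_ge0 ?(ltW kappa0).
  by rewrite !indicE mulr_ge0.
have [p q] := F_pos xD tD.
rewrite !indicE !mem_set// !mulr1 /lik_ratio/=.
have -> : (F x t * (1 + (F' x t - F x t) / F x t) ^+ 2 +
   (1 - F x t) * (1 - (F' x t - F x t) / (1 - F x t)) ^+ 2 =
   1 + (F' x t - F x t) ^+ 2 / (F x t * (1 - F x t)))%R.
  by field; rewrite !gt_eqF.
rewrite lerD2l ler_pM ?invr_ge0 ?sqr_ge0 ?mulr_ge0 ?(ltW p) ?(ltW q)//.
  rewrite -[leLHS]real_normK ?num_real// lerXn2r ?nnegrE ?F_close//.
  exact: le_trans (F_close xD tD).
by rewrite lef_pV2 ?F_on// posrE ?mulr_gt0.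
Qed.

Let v1_ge0 : (0 <= v1)%R. Proof. by rewrite -lee_fin -D1_mass. Qed.
Let v2_ge0 : (0 <= v2)%R. Proof. by rewrite -lee_fin -D2_mass. Qed.

Let C_ge0 : (0 <= h1 * (delta ^+ 2 / kappa))%R.
Proof. by rewrite mulr_ge0// divr_ge0 ?sqr_ge0// ltW. Qed.

Let kap_ge0 : (0 <= kap)%R.
Proof.
apply: addr_ge0 => //; apply: mulr_ge0 => //; apply: mulr_ge0 => //.
by rewrite -mulrA.
Qed.

(** Integrates [ratio_sqr_le]. The density keeps its total mass 1 in the constant term and is
    bounded by [h1] only in the term carried by the cell. *)
Lemma obsInt_ratio_sqr : obsInt F fd (fun o => (lik_ratio o ^+ 2)%:E) <= kap%:E.
Proof.
pose C := (h1 * (delta ^+ 2 / kappa))%R.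
have m1 (x : R) : measurable_fun setT (fun t => (fd (x, t))%:E).
  by apply/measurable_EFinP; exact: measurable_fun_pair2.
have mC (x : R) : measurable_fun setT (fun t : R => (C * (\1_D1 x * \1_D2 t))%:E).
  by apply/measurable_EFinP; do 2!apply: measurable_funM => //.
have pC (x t : R) : 0 <= (C * (\1_D1 x * \1_D2 t))%:E.
  by rewrite lee_fin mulr_ge0// mulr_ge0// indicE.
apply: (@le_trans _ _ (\int[mu]_x \int[mu]_t
    ((fd (x, t))%:E + (C * (\1_D1 x * \1_D2 t))%:E))).
  rewrite /obsInt; apply: ge0_le_integral_dom => // [x _|x _|x _].
  - apply: integral_ge0 => t _; rewrite -!EFinM lee_fin.
    have /andP[f0 f1] := F01 x t.
    apply: mulr_ge0 => //; apply: addr_ge0; apply: mulr_ge0; rewrite ?sqr_ge0//.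
    by rewrite subr_ge0.
  - by apply: integral_ge0 => t _; apply: adde_ge0; rewrite ?pC// lee_fin.
  apply: ge0_le_integral_dom => // t _.
  - rewrite -!EFinM lee_fin.
    have /andP[f0 f1] := F01 x t.
    apply: mulr_ge0 => //; apply: addr_ge0; apply: mulr_ge0; rewrite ?sqr_ge0//.
    by rewrite subr_ge0.
  - by apply: adde_ge0; rewrite ?pC// lee_fin.
  rewrite -!EFinM -EFinD lee_fin.
  apply: (le_trans (ler_wpM2l (fd0 _) (ratio_sqr_le x t))).
  rewrite mulrDr mulr1 lerD2l /C -[leRHS]mulrA ler_wpM2r//.
  apply: mulr_ge0; first by rewrite divr_ge0 ?sqr_ge0 ?(ltW kappa0).
  by rewrite !indicE mulr_ge0.
have mfdF : measurable_fun setT (fun x => \int[mu]_t (fd (x, t))%:E).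
  apply: (measurable_fun_fubini_tonelli_F (m2 := mu) (fun p => (fd p)%:E)) => //.
  exact/measurable_EFinP.
have inner (x : R) : \int[mu]_t ((fd (x, t))%:E + (C * (\1_D1 x * \1_D2 t))%:E) =
    \int[mu]_t (fd (x, t))%:E + (C * v2)%:E * (\1_D1 x)%:E.
  rewrite ge0_integralD; [|exact: measurableT|by move=> t _; rewrite lee_fin
    |exact: m1|by move=> t _; exact: pC|exact: mC].
  congr (_ + _).
  under eq_integral do rewrite mulrA EFinM.
  rewrite ge0_integralZl_EFin//.
  - rewrite integral_indic// setIT [X in _ * X](_ : _ = v2%:E)// -!EFinM.
    by congr EFin; ring.
  - exact/measurable_EFinP.
  - by rewrite mulr_ge0// indicE.
under eq_integral do rewrite inner.
rewrite ge0_integralD//.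
- rewrite fd1 ge0_integralZl_EFin//.
  + rewrite integral_indic// setIT [X in _ * X](_ : _ = v1%:E)//.
    rewrite -!EFinM -EFinD lee_fin /kap /C.
    by rewrite le_eqVlt; apply/orP; left; apply/eqP; ring.
  + exact/measurable_EFinP.
  + exact: mulr_ge0.
- by move=> x _; apply: integral_ge0 => t _; rewrite lee_fin.
- by move=> x _; rewrite -EFinM lee_fin; apply: mulr_ge0; [exact: mulr_ge0|rewrite indicE].
- by apply: measurable_funeM; exact/measurable_EFinP.
Qed.

(* The weight [w] plays the part of a likelihood ratio of past observations. *)
Let one_step (A B : obs -> \bar R) (d K w : R) :
  measurable_fun setT A -> measurable_fun setT B ->
  (forall o, 0 <= A o) -> (forall o, 0 <= B o) ->
  (0 <= d)%R -> (0 <= K)%R ->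
  (forall o (u : R), (0 <= u)%R ->
    (d * u)%:E <= A o + u%:E * B o + (d * K / 4 * u ^+ 2)%:E) ->
  (0 <= w)%R ->
  (d * w)%:E <= obsInt F fd A + w%:E * obsInt F' fd B
                + (d * (K * kap) / 4 * w ^+ 2)%:E.
Proof.
move=> mA mB A0 B0 d0 K0 AB w0.
have mLB : measurable_fun setT (fun o => (lik_ratio o)%:E * B o).
  by apply: emeasurable_funM => //; exact/measurable_EFinP.
have LB0 o : 0 <= (lik_ratio o)%:E * B o by rewrite mule_ge0 ?lee_fin.
have mL2 : measurable_fun setT (fun o => (lik_ratio o ^+ 2)%:E).
  by apply/measurable_EFinP; exact: measurable_funX.
have L20 o : 0 <= (lik_ratio o ^+ 2)%:E by rewrite lee_fin sqr_ge0.
have e0 : (0 <= d * K / 4 * w ^+ 2)%R by rewrite !mulr_ge0 ?sqr_ge0.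
(* The ratio has mean 1 under [F]. Everything then sits under one integral, where [AB] applies with
   [u = w * lik_ratio o]. *)
have -> : (d * w)%:E =
    obsInt F fd (fun o => (d * w)%:E * ((lik_ratio o)%:E * 1)).
  rewrite obsIntZ ?obsInt_ratio ?obsInt_cst1 ?mule1 ?mulr_ge0//.
  - by apply: emeasurable_funM => //; exact/measurable_EFinP.
  - by move=> o; rewrite mule1 lee_fin.
apply: (@le_trans _ _ (obsInt F fd (fun o => A o + w%:E * ((lik_ratio o)%:E * B o)
    + (d * K / 4 * w ^+ 2)%:E * (lik_ratio o ^+ 2)%:E))).
  apply: le_obsInt => // o; first by rewrite !mule1 -EFinM lee_fin !mulr_ge0.
  have := AB o _ (mulr_ge0 w0 (ratio_ge0 o)); rewrite mule1 muleA -!EFinM.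
  by rewrite exprMn !mulrA.
rewrite obsIntD//.
- rewrite obsIntD//.
  + rewrite !obsIntZ// obsInt_ratio leeD2l//.
    have -> : (d * (K * kap) / 4 * w ^+ 2 = d * K / 4 * w ^+ 2 * kap)%R by ring.
    by rewrite [leRHS]EFinM lee_wpmul2l// obsInt_ratio_sqr.
  + exact: measurable_funeM.
  + by move=> o; apply: mule_ge0.
- by apply: emeasurable_funD => //; exact: measurable_funeM.
- exact: measurable_funeM.
- by move=> o; apply: adde_ge0 => //; apply: mule_ge0.
- by move=> o; apply: mule_ge0.
Qed.

(* [u - u ^+ 2 / 4] is a lower bound of [min 1 u] whose integral against a
   likelihood ratio only involves the second moment of that ratio. *)
Let base_case (a b : \bar R) (d u : R) : 0 <= a -> 0 <= b -> (0 <= d)%R ->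
  d%:E <= a + b -> (0 <= u)%R -> (d * u)%:E <= a + u%:E * b + (d * 1 / 4 * u ^+ 2)%:E.
Proof.
move=> a0 b0 d0 dab u0; have [u1|u1] := leP u 1%R.
  apply: (@le_trans _ _ (u%:E * (a + b))).
    by rewrite mulrC EFinM lee_wpmul2l ?lee_fin.
  rewrite ge0_muleDr// -[leLHS]adde0; apply: leeD; last first.
    by rewrite lee_fin !mulr_ge0 ?sqr_ge0.
  by apply: leeD => //; rewrite -[leRHS]mul1e lee_wpmul2r// lee_fin.
apply: (@le_trans _ _ (d%:E + (d * 1 / 4 * u ^+ 2)%:E)).
  rewrite -EFinD lee_fin -subr_ge0.
  (* Completing the square is what dictates the factor 4. *)
  have -> : (d + d * 1 / 4 * u ^+ 2 - d * u = d * (1 - u / 2) ^+ 2)%R by field.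
  by rewrite mulr_ge0 ?sqr_ge0.
apply: leeD => //; apply: (le_trans dab); apply: leeD => //.
by rewrite -[leLHS]mul1e lee_wpmul2r// lee_fin ltW.
Qed.

(** Peeling off an observation multiplies the weight by its likelihood ratio, hence the
    quantification over [w]; integrating it out multiplies the quadratic error by [kap]. The
    exponent is [n.+1] because [sample R n] holds [n.+1] observations. *)
Lemma two_point_induction n (a b : sample R n -> \bar R) (d w : R) :
  measurable_fun setT a -> measurable_fun setT b ->
  (forall s, 0 <= a s) -> (forall s, 0 <= b s) -> (0 <= d)%R ->
  (forall s, d%:E <= a s + b s) -> (0 <= w)%R ->
  (d * w)%:E <= sampleInt F fd a + w%:E * sampleInt F' fd b
                + (d * kap ^+ n.+1 / 4 * w ^+ 2)%:E.
Proof.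
elim: n a b w => [|n IH] a b w ma mb a0 b0 d0 dab w0.
  rewrite expr1 -[kap]mul1r; apply: one_step => // o u u0; exact: base_case.
rewrite exprSr /=; apply: one_step => //.
- exact: measurable_sampleInt_slice.
- exact: measurable_sampleInt_slice.
- by move=> o; exact: sampleInt_ge0.
- by move=> o; exact: sampleInt_ge0.
- exact: exprn_ge0.
move=> o u u0; apply: IH => //; exact: measurable_fun_pair2.
Qed.

(** At [w = 1] the quadratic error is at most [d * 2 / 4], which leaves half of [d]. *)
Lemma two_point_bound n (a b : sample R n -> \bar R) (d : R) :
  measurable_fun setT a -> measurable_fun setT b ->
  (forall s, 0 <= a s) -> (forall s, 0 <= b s) -> (0 <= d)%R ->
  (forall s, d%:E <= a s + b s) ->
  ((1 + h1 * delta ^+ 2 / kappa * v1 * v2) ^+ n.+1 <= 2)%R ->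
  (d / 2)%:E <= sampleInt F fd a + sampleInt F' fd b.
Proof.
move=> ma mb a0 b0 d0 dab k2.
have := two_point_induction ma mb a0 b0 d0 dab ler01.
rewrite mulr1 mul1e expr1n mulr1 => H.
have : d%:E <= sampleInt F fd a + sampleInt F' fd b + (d / 2)%:E.
  apply: (le_trans H); apply: leeD => //; rewrite lee_fin -mulrA ler_wpM2l//.
  have -> : (2^-1 = 2 / 4 :> R)%R by field.
  by rewrite ler_wpM2r.
by rewrite -leeBlDr// -EFinB; have -> : (d - d / 2 = d / 2)%R by field.
Qed.

End TwoPoints.

(** * Tools: averaging over a cube, distribution functions, rectangles *)

Section CubeAverage.
Context {R : realType} {I : finType}.

Definition flip (q : I) (s : {ffun I -> bool}) : {ffun I -> bool} :=
  [ffun i => if i == q then ~~ s i else s i].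

Lemma flipK q : involutive (flip q).
Proof.
by move=> s; apply/ffunP => i; rewrite !ffunE; case: eqP => // _; rewrite negbK.
Qed.

(** Assouad's averaging: pairing each vertex with its neighbour across [q] gives [S] a mean of at
    least [c] in every direction [q], so some vertex reaches the mean of the sums. *)
Lemma cube_average (S : {ffun I -> bool} -> I -> \bar R) (c : R) :
  (forall s q, (0 <= S s q)%E) ->
  (forall s q, ((c + c)%:E <= S s q + S (flip q s) q)%E) ->
  exists s, ((#|I|%:R * c)%:E <= \sum_q S s q)%E.
Proof.
move=> S0 Sc; apply: contrapT => /forallNP noS.
have lt s : (\sum_q S s q < (#|I|%:R * c)%:E)%E.
  by rewrite ltNge; apply/negP; exact: noS.
(* The negated conclusion makes every term finite, so that the averaging takes place in [R]. *)
have Sfin s q : S s q \is a fin_num.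
  rewrite ge0_fin_numE//; apply: le_lt_trans (lt_trans (lt s) (ltry _)).
  by rewrite (bigD1 q)//= leeDl// sume_ge0.
pose r s q := fine (S s q).
have SE s q : S s q = (r s q)%:E by rewrite fineK.
have rlt s : \sum_q r s q < #|I|%:R * c.
  by rewrite -lte_fin -sumEFin (eq_bigr (S s))// => q _; rewrite -SE.
have rc s q : c + c <= r s q + r (flip q s) q.
  by rewrite -lee_fin [leRHS]EFinD -!SE.
suff : \sum_s \sum_q r s q >= \sum_(s : {ffun I -> bool}) #|I|%:R * c.
  by rewrite leNgt ltr_sum//; apply/hasP; exists [ffun=> true]; rewrite ?mem_index_enum.
rewrite exchange_big/=.
have -> : \sum_(s : {ffun I -> bool}) #|I|%:R * c =
    \sum_(q : I) \sum_(s : {ffun I -> bool}) c.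
  by rewrite [RHS]exchange_big/=; apply: eq_bigr => s _; rewrite sumr_const mulr_natl.
apply: ler_sum => q _.
have -> : \sum_s r s q = (\sum_s (r s q + r (flip q s) q)) / 2.
  have E : \sum_s r (flip q s) q = \sum_s r s q.
    by rewrite [RHS](reindex_inj (inv_inj (flipK q))).
  by rewrite big_split/= E; field.
rewrite ler_pdivlMr// mulr_suml; apply: ler_sum => s _.
by apply: le_trans (rc s q); rewrite mulr_natr mulr2n.
Qed.

End CubeAverage.

Section ProbabilityFromCdf.
Context {R : realType} (f : R -> R) (Y : R).
Hypothesis f_nd : nondecreasing f.
Hypothesis f_rc : right_continuous f.
Hypothesis f_le0 : forall y, y <= 0 -> f y = 0.
Hypothesis f_geY : forall y, Y <= y -> f y = 1.

#[local] HB.instance Definition _ := isCumulative.Build R _ R f f_nd f_rc.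

Let f_Ny : f @ -oo --> (0 : R).
Proof.
apply: cvg_near_cst; near=> y; apply/f_le0.
by near: y; exact: nbhs_ninfty_le.
Unshelve. all: by end_near. Qed.

Let f_y : f @ +oo --> (1 : R).
Proof.
apply: cvg_near_cst; near=> y; apply/f_geY.
by near: y; apply: nbhs_pinfty_ge; exact: num_real.
Unshelve. all: by end_near. Qed.

#[local] HB.instance Definition _ := isCumulativeBounded.Build R 0 1 f f_Ny f_y.

(* The Stieltjes measure lives on [measurableTypeR R], which has the same
   measurable sets as [R] but is another structure. *)
Let idTR : measurableTypeR R -> R := idfun.

#[local] HB.instance Definition _ :=
  @isMeasurableFun.Build _ _ _ _ idTR (@measurable_id _ _ setT).

Let lsf : probability (measurableTypeR R) R := lebesgue_stieltjes_measure f.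

(** The measure is the Lebesgue-Stieltjes measure of [f]; the limits at infinity are attained, and
    [f 0 = 0] puts all the mass on the positive half-line. *)
Lemma probability_of_cdf : exists P : probability R R,
  P `]0, +oo[%classic = 1%E /\ forall y, (f y)%:E = P `]-oo, y]%classic.
Proof.
pose P : probability R R := distribution lsf (idTR : {RV lsf >-> R}).
have PE y : (f y)%:E = P `]-oo, y]%classic.
  by rewrite -(cdf_lebesgue_stieltjes_id f y).
exists P; split=> //.
have -> : `]0, +oo[%classic = ~` `]-oo, (0 : R)]%classic :> set R.
  by rewrite setCitvl.
rewrite probability_setC; last exact: measurable_itv.
by rewrite -PE f_le0// sube0.
Qed.

End ProbabilityFromCdf.

Section RectangleNorm.
Context {R : realType}.
Local Notation mu := (@lebesgue_measure R).
Implicit Types (g : R -> R -> R).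
Local Open Scope ereal_scope.

(** The domains are only included in intervals, in order to cover the sets [shrink]. *)
Lemma L2norm_bounded (D1 D2 : set R) (a1 b1 a2 b2 K : R) g :
  D1 `<=` `[a1, b1]%classic -> D2 `<=` `[a2, b2]%classic ->
  (a1 <= b1)%R -> (a2 <= b2)%R -> (0 <= K)%R ->
  (forall x y, D1 x -> D2 y -> `|g x y| <= K)%R ->
  L2norm D1 D2 g <= (K * Num.sqrt ((b1 - a1) * (b2 - a2)))%:E.
Proof.
move=> D1A D2A ab1 ab2 K0 gK.
have -> : (K * Num.sqrt ((b1 - a1) * (b2 - a2)) =
    Num.sqrt (K ^+ 2 * ((b1 - a1) * (b2 - a2))))%R.
  by rewrite [RHS]sqrtrM ?sqr_ge0// sqrtr_sqr ger0_norm.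
rewrite /L2norm -[leRHS]/(sqrte (K ^+ 2 * ((b1 - a1) * (b2 - a2)))%:E).
rewrite lee_sqrt//; last first.
  by rewrite lee_fin mulr_ge0 ?sqr_ge0// mulr_ge0 ?subr_ge0.
have ge0 x y : 0 <= ((g x y) ^+ 2)%:E by rewrite lee_fin sqr_ge0.
apply: (@le_trans _ _ (\int[mu]_(x in `[a1, b1]) \int[mu]_(y in `[a2, b2]) (K ^+ 2)%:E)).
  apply: ge0_le_integral_dom => // [x _|x _|x Dx].
  - exact: integral_ge0.
  - by apply: integral_ge0 => y _; rewrite lee_fin sqr_ge0.
  apply: ge0_le_integral_dom => // y; first by rewrite lee_fin sqr_ge0.
  move=> Dy; rewrite lee_fin -[leLHS]real_normK ?num_real//.
  by rewrite lerXn2r ?nnegrE// gK.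
have mass (a b : R) : (a <= b)%R -> mu `[a, b]%classic = (b - a)%:E.
  rewrite lebesgue_measure_itv/= lte_fin le_eqVlt => /orP[/eqP ->|->].
    by rewrite ltxx subrr.
  by rewrite EFinB.
under eq_integral do rewrite integral_cst//= mass// -EFinM.
by rewrite integral_cst//= mass// -EFinM lee_fin [X in (_ <= _ * X)%R]mulrC mulrA.
Qed.

Lemma le_L2sq (A1 A2 : set R) (W : R -> R -> \bar R) g :
  (forall x y, 0 <= W x y) ->
  (forall x y, A1 x -> A2 y -> W x y <= (g x y ^+ 2)%:E) ->
  (forall x y, ~ (A1 x /\ A2 y) -> W x y = 0) ->
  \int[mu]_x \int[mu]_y W x y <= L2sq A1 A2 g.
Proof.
move=> W0 Wg Woff; rewrite /L2sq [leRHS]integral_mkcond.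
have ge0 x y : 0 <= ((g x y) ^+ 2)%:E by rewrite lee_fin sqr_ge0.
apply: ge0_le_integral_dom => [//|x _|x _|x _].
- by apply: integral_ge0 => y _; exact: W0.
- by rewrite /patch; case: ifP => // _; apply: integral_ge0.
rewrite /patch; case: ifPn => [|/negP]; rewrite inE => xA; last first.
  by rewrite integral0_eq// => y _; rewrite Woff// => -[].
rewrite [leRHS]integral_mkcond.
apply: ge0_le_integral_dom => [//|y _|y _|y _]; first exact: W0.
  by rewrite /patch; case: ifP.
rewrite /patch; case: ifPn => [|/negP]; rewrite inE => yA; first exact: Wg.
by rewrite Woff// => -[].
Qed.

End RectangleNorm.

(** * The hypercube of conditional distribution functions *)

Section FiniteDifferenceAlgebra.
Variable R : realType.
Implicit Types (r : nat) (h x : R) (f g : R -> R).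

Lemma fdiffZ r h (k : R) f x : fdiff r h (fun t => k * f t) x = k * fdiff r h f x.
Proof. by rewrite /fdiff mulr_sumr; apply: eq_bigr => i _; rewrite mulrCA. Qed.

Lemma fdiff_cst r h (k : R) x : fdiff r.+1 h (fun=> k) x = 0.
Proof.
have : `|fdiff r.+1 h (fun=> k) x| <= `|h| ^+ r.+1 * 0.
  apply: (@fdiff_derive_bounded _ _ _ (fun i => if i is 0 then fun=> k else fun=> 0)).
    by move=> [|i] _ t; exact: is_derive_cst.
  by move=> t; rewrite normr0.
by rewrite mulr0 normr_le0 => /eqP.
Qed.

Lemma fdiff_linear r h (k : R) x : fdiff r.+2 h (fun t => k * t) x = 0.
Proof.
rewrite fdiffZ; have -> : fdiff r.+2 h id x = 0; last by rewrite mulr0.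
have : `|fdiff r.+2 h id x| <= `|h| ^+ r.+2 * 0.
  apply: (@fdiff_derive_bounded _ _ _ (fun i => match i with
    | 0 => id | 1 => fun=> 1 | _ => fun=> 0 end)).
    move=> [|[|i]] _ t; [exact: is_derive_id|exact: is_derive_cst..].
  by move=> t; rewrite normr0.
by rewrite mulr0 normr_le0 => /eqP.
Qed.

(** Up to constants [X] is below both 1 and [(t / w) ^+ r], and the smaller of the two is at most
    [t / w] to the power [b], since [0 <= b <= r]. *)
Lemma min_scaling (t w b M X : R) r : 0 < t -> 0 < w -> 0 <= b -> b <= r%:R ->
  1 <= M -> X <= (t / w) ^+ r * M -> X <= 2 ^+ r ->
  X <= 2 ^+ r * M * w `^ (- b) * t `^ b.
Proof.
move=> t0 w0 b0 br M1 X1 X2.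
have tw0 : 0 < t / w by rewrite divr_gt0.
have tw : w `^ (- b) * t `^ b = (t / w) `^ b.
  by rewrite powRM ?invr_ge0 ?(ltW w0) ?(ltW t0)// -powR_inv1 ?(ltW w0)// -powRrM mulN1r mulrC.
rewrite -mulrA tw.
have [tw1|/ltW tw1] := leP (t / w) 1.
  apply: (le_trans X1); rewrite -[leRHS]mulrA [M * _]mulrC mulrA.
  rewrite ler_wpM2r ?(le_trans _ M1)// -powR_mulrn ?(ltW tw0)//.
  apply: (@le_trans _ _ ((t / w) `^ b)); first by rewrite ger_powR// tw0.
  by rewrite ler_peMl ?powR_ge0// exprn_ege1 ?ler1n.
apply: (le_trans X2); rewrite -[leLHS]mulr1 -mulrA ler_wpM2l ?exprn_ge0//.
rewrite -[1]mulr1 ler_pM// -[1](powRr0 (t / w)).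
by apply: ler_powR.
Qed.

End FiniteDifferenceAlgebra.

Section Hypercube.
Context {R : realType}.
Variables (a1 b1 a2 b2 : R).
Hypothesis ab1 : a1 < b1.
Hypothesis a2_ge0 : 0 <= a2.
Hypothesis ab2 : a2 < b2.
Variables (m1 m2 deg : nat) (eps gam M : R).
Hypothesis m1_gt0 : (0 < m1)%N.
Hypothesis m2_gt0 : (0 < m2)%N.
Hypothesis deg_gt1 : (1 < deg)%N.
Hypothesis eps_gt0 : 0 < eps.
Hypothesis eps_le : eps * b2 <= 1 / 2.
Hypothesis gam_ge0 : 0 <= gam.
Hypothesis M_ge1 : 1 <= M.
Local Notation psi := (bumpX R ^+ deg).
Hypothesis psi_deriv : forall k u, `|cut psi^`(k) u| <= M.

(** Perturbing only above the midpoint keeps [eps * y] away from 0 even when [a2 = 0], and with it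
    the Bernoulli variance. *)
Definition mid : R := (a2 + b2) / 2.
Definition width1 : R := (b1 - a1) / m1%:R.
Definition width2 : R := (b2 - mid) / m2%:R.
Definition coord1 (j : nat) (x : R) : R := (x - a1) / width1 - j%:R.
Definition coord2 (k : nat) (y : R) : R := (y - mid) / width2 - k%:R.

Hypothesis gam_le : gam * M / width2 <= eps.

Local Notation cell := ('I_m1 * 'I_m2)%type.
Local Notation vertex := {ffun cell -> bool}.
Implicit Types (s : vertex) (q : cell).

Definition cell_bump q (x y : R) : R :=
  cut psi (coord1 q.1 x) * cut psi (coord2 q.2 y).
Definition pert s (x y : R) : R := \sum_q (s q)%:R * cell_bump q x y.
Definition tilted s (x y : R) : R := eps * y + gam * pert s x y.
(* Linear in [y] up to the perturbation, as long as the values lie in [0, 1]. *)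
Definition hyp_cdf s (x y : R) : R := Num.max 0 (Num.min 1 (tilted s x y)).

Let M_ge0 : 0 <= M. Proof. exact: le_trans M_ge1. Qed.

Lemma mid_gt0 : 0 < mid.
Proof. by rewrite divr_gt0// ltr_wpDl// (le_lt_trans a2_ge0). Qed.

Lemma mid_lt : mid < b2.
Proof. by have := ab2; rewrite /mid; lra. Qed.

Lemma mid_ge : a2 <= mid.
Proof. by have := ab2; rewrite /mid; lra. Qed.

Lemma b2_gt0 : 0 < b2. Proof. exact: le_lt_trans ab2. Qed.

Lemma width1_gt0 : 0 < width1.
Proof. by rewrite divr_gt0 ?subr_gt0 ?ltr0n. Qed.

Lemma width2_gt0 : 0 < width2.
Proof. by rewrite divr_gt0 ?subr_gt0 ?ltr0n// mid_lt. Qed.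

Lemma cut_psi_01 u : 0 <= cut psi u <= 1.
Proof.
rewrite /cut; case: ifP => [/andP[u0 u1]|_]; last by rewrite lexx ler01.
rewrite horner_exp bumpXE.
have v0 : 0 <= u * (1 - u) by rewrite mulr_ge0 ?subr_ge0 ?(ltW u0) ?(ltW u1).
rewrite exprn_ge0//= exprn_ile1// mulr_ile1 ?subr_ge0 ?(ltW u0) ?(ltW u1)//.
by rewrite gerBl ltW.
Qed.

Lemma cut_psi_le1 u : `|cut psi u| <= 1.
Proof. by have /andP[u0 u1] := cut_psi_01 u; rewrite ger0_norm. Qed.

Lemma bump_01 q x y : 0 <= cell_bump q x y <= 1.
Proof.
have /andP[u0 u1] := cut_psi_01 (coord1 q.1 x).
have /andP[v0 v1] := cut_psi_01 (coord2 q.2 y).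
by rewrite mulr_ge0//= mulr_ile1.
Qed.

(** With one coordinate frozen, the perturbation is a wave in the other whose coefficients are
    themselves waves bounded by 1. Both directions thus reduce to the one-variable bounds. *)
Lemma pert_wave1 s y : pert s ^~ y = wave psi a1 width1
  (fun j : 'I_m1 => wave psi mid width2 (fun k : 'I_m2 => (s (j, k))%:R) y).
Proof.
apply/funext => x; rewrite /pert /wave /cell_bump.
under [RHS]eq_bigr do rewrite mulr_suml.
rewrite pair_bigA/=; apply: eq_bigr => -[j k] _ /=.
by rewrite mulrA mulrAC.
Qed.

Lemma pert_wave2 s x : pert s x = wave psi mid width2
  (fun k : 'I_m2 => wave psi a1 width1 (fun j : 'I_m1 => (s (j, k))%:R) x).
Proof.
apply/funext => y; rewrite /pert /wave /cell_bump.
under [RHS]eq_bigr do rewrite mulr_suml.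
rewrite exchange_big pair_bigA/=; apply: eq_bigr => -[j k] _ /=.
by rewrite mulrA.
Qed.

Let vertex_le1 s q : `|(s q)%:R : R| <= 1.
Proof. by case: (s q); rewrite ?normr1 ?normr0 ?ler01. Qed.

Let coef1_le1 s y (j : 'I_m1) :
  `|wave psi mid width2 (fun k : 'I_m2 => (s (j, k))%:R) y| <= 1.
Proof. by apply: wave_bounded => // u; exact: cut_psi_le1. Qed.

Let coef2_le1 s x (k : 'I_m2) :
  `|wave psi a1 width1 (fun j : 'I_m1 => (s (j, k))%:R) x| <= 1.
Proof. by apply: wave_bounded => // u; exact: cut_psi_le1. Qed.

Lemma pert_le1 s x y : `|pert s x y| <= 1.
Proof.
rewrite pert_wave2; apply: wave_bounded => // u; exact: cut_psi_le1.
Qed.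

Lemma fdiff_pert1 s r (h x y t b : R) : (r < deg)%N -> 0 < t -> `|h| <= t ->
  0 <= b -> b <= r%:R ->
  `|fdiff r h (pert s ^~ y) x| <= 2 ^+ r * M * width1 `^ (- b) * t `^ b.
Proof.
move=> rd t0 ht b0 br; apply: min_scaling => //; first exact: width1_gt0.
  rewrite pert_wave1.
  apply: le_trans (fdiff_wave_small h _ rd width1_gt0 (coef1_le1 s y) psi_deriv x) _.
  apply: ler_wpM2r => //; apply: lerXn2r; rewrite ?nnegrE.
  - exact: divr_ge0 (normr_ge0 _) (ltW width1_gt0).
  - exact: divr_ge0 (ltW t0) (ltW width1_gt0).
  - by apply: ler_wpM2r => //; rewrite invr_ge0 (ltW width1_gt0).
rewrite -[leRHS]mulr1; apply: fdiff_bounded => u; exact: pert_le1.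
Qed.

Lemma fdiff_pert2 s r (h x y t b : R) : (r < deg)%N -> 0 < t -> `|h| <= t ->
  0 <= b -> b <= r%:R ->
  `|fdiff r h (pert s x) y| <= 2 ^+ r * M * width2 `^ (- b) * t `^ b.
Proof.
move=> rd t0 ht b0 br; apply: min_scaling => //; first exact: width2_gt0.
  rewrite pert_wave2.
  apply: le_trans (fdiff_wave_small h _ rd width2_gt0 (coef2_le1 s x) psi_deriv y) _.
  apply: ler_wpM2r => //; apply: lerXn2r; rewrite ?nnegrE.
  - exact: divr_ge0 (normr_ge0 _) (ltW width2_gt0).
  - exact: divr_ge0 (ltW t0) (ltW width2_gt0).
  - by apply: ler_wpM2r => //; rewrite invr_ge0 (ltW width2_gt0).
rewrite -[leRHS]mulr1; apply: fdiff_bounded => u; exact: pert_le1.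
Qed.

(** The first-order case of [fdiff_wave_small], with step [z - y]. *)
Lemma pert_lipschitz s x y z : `|pert s x z - pert s x y| <= `|z - y| / width2 * M.
Proof.
have := fdiff_wave_small (z - y) mid deg_gt1 width2_gt0 (coef2_le1 s x) psi_deriv y.
by rewrite fdiffS !fdiff0 -pert_wave2 expr1 addrCA subrr addr0.
Qed.

Lemma coord2_bounds (k : 'I_m2) y : 0 < coord2 k y < 1 -> mid < y < b2.
Proof.
rewrite /coord2 => /andP[k0 k1]; apply/andP; split.
  rewrite -subr_gt0 -(pmulr_lgt0 _ (_ : 0 < width2^-1)) ?invr_gt0 ?width2_gt0//.
  by rewrite (le_lt_trans (ler0n _ k))// -subr_gt0.
move: k1; rewrite ltrBlDr => k1; rewrite ltNge; apply: contraTN k1 => yb.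
have : (k : nat).+1%:R <= m2%:R :> R by rewrite ler_nat.
rewrite -natr1 addrC -leNgt => /le_trans; apply.
rewrite /width2 invf_div mulrA ler_pdivlMr ?subr_gt0 ?mid_lt// mulrC.
by rewrite ler_wpM2r// lerD2r.
Qed.

Lemma bump_off2 q x y : y <= mid \/ b2 <= y -> cell_bump q x y = 0.
Proof.
move=> ymid; rewrite /cell_bump [X in _ * X](_ : _ = 0) ?mulr0//.
rewrite /cut; case: ifPn => // /coord2_bounds/andP[my yb].
by case: ymid; rewrite leNgt ?my ?yb.
Qed.

Lemma pert_off2 s x y : y <= mid \/ b2 <= y -> pert s x y = 0.
Proof. by move=> ym; rewrite /pert big1// => q _; rewrite bump_off2 ?mulr0. Qed.

(** By [gam_le] the slope [gam * M / width2] of the perturbation never exceeds the slope [eps] of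
    the tilt. *)
Lemma tilted_nd s x : {homo tilted s x : y z / y <= z}.
Proof.
move=> y z yz; rewrite /tilted -subr_ge0.
have -> : eps * z + gam * pert s x z - (eps * y + gam * pert s x y) =
  eps * (z - y) + gam * (pert s x z - pert s x y) by ring.
have H : `|gam * (pert s x z - pert s x y)| <= eps * (z - y).
  rewrite normrM (ger0_norm gam_ge0).
  apply: (le_trans (ler_wpM2l gam_ge0 (pert_lipschitz s x y z))).
  have -> : gam * (`|z - y| / width2 * M) = gam * M / width2 * `|z - y| by ring.
  by rewrite ger0_norm ?subr_ge0// ler_wpM2r ?subr_ge0.
by move: H; rewrite ler_norml => /andP[H _]; rewrite -lerBlDl sub0r.
Qed.

Lemma tilted_off2 s x y : y <= mid \/ b2 <= y -> tilted s x y = eps * y.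
Proof. by move=> ym; rewrite /tilted pert_off2// mulr0 addr0. Qed.

(** Monotonicity, together with the values at 0 and [b2], where the perturbation vanishes. *)
Lemma tilted_0b2 s x y : 0 <= y <= b2 -> 0 <= tilted s x y <= eps * b2.
Proof.
case/andP => y0 yb; apply/andP; split.
  apply: le_trans (tilted_nd s x y0); rewrite tilted_off2 ?mulr0//.
  by left; exact: ltW mid_gt0.
by apply: le_trans (tilted_nd s x yb) _; rewrite tilted_off2//; right.
Qed.

Lemma hyp_cdfE s x y : 0 <= y <= b2 -> hyp_cdf s x y = tilted s x y.
Proof.
move=> /(tilted_0b2 s x)/andP[t0 t1]; rewrite /hyp_cdf min_r ?max_r//.
by apply: (le_trans t1); apply: (le_trans eps_le); lra.
Qed.

Lemma hyp_cdf_01 s x y : 0 <= hyp_cdf s x y <= 1.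
Proof. by rewrite /hyp_cdf le_max lexx/= ge_max ler01/= ge_min lexx. Qed.

Lemma measurable_cut_psi : measurable_fun setT (cut psi).
Proof.
apply: continuous_measurable_fun => u.
apply: differentiable_continuous; apply/derivable1_diffP.
have pW : bumpX R ^+ 2 %| psi by exact: dvdp_exp2l.
exact: (@ex_derive _ _ _ _ _ _ _ (is_derive_cut u pW)).
Qed.

Lemma measurable_bump q : measurable_fun setT (fun p : R * R => cell_bump q p.1 p.2).
Proof.
have maff (c w : R) j : measurable_fun setT (fun x : R => (x - c) / w - j).
  by apply: measurable_funB => //; apply: measurable_funM => //; exact: measurable_funB.
apply: measurable_funM.
  apply: (measurableT_comp measurable_cut_psi).
  exact: (measurableT_comp (maff _ _ _)).
apply: (measurableT_comp measurable_cut_psi).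
exact: (measurableT_comp (maff _ _ _)).
Qed.

Lemma measurable_tilted s : measurable_fun setT (fun p : R * R => tilted s p.1 p.2).
Proof.
apply: measurable_funD; first by apply: measurable_funM.
apply: measurable_funM => //; apply: measurable_sum => q.
by apply: measurable_funM => //; exact: measurable_bump.
Qed.

Lemma measurable_hyp_cdf s : measurable_fun setT (fun p : R * R => hyp_cdf s p.1 p.2).
Proof.
apply: measurable_maxr => //; apply: measurable_minr => //; exact: measurable_tilted.
Qed.

Lemma clamp_contraction (u v : R) : u <= v ->
  `|Num.max 0 (Num.min 1 v) - Num.max 0 (Num.min 1 u)| <= v - u.
Proof.
have cl (w : R) : [\/ w <= 0 /\ Num.max 0 (Num.min 1 w) = 0,
    1 <= w /\ Num.max 0 (Num.min 1 w) = 1 |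
    0 <= w <= 1 /\ Num.max 0 (Num.min 1 w) = w].
  have [w0|/ltW w0] := leP w 0.
    by apply: Or31; rewrite min_r ?max_l// (le_trans w0).
  have [w1|/ltW w1] := leP 1 w; first by apply: Or32; rewrite max_r.
  by apply: Or33; rewrite max_r ?w0 ?w1.
move=> uv; rewrite ler_norml; apply/andP.
by case: (cl u) => -[u0 ->]; case: (cl v) => -[v0 ->]; split; lra.
Qed.

Lemma hyp_cdf_lipschitz s x y z : y <= z ->
  `|hyp_cdf s x z - hyp_cdf s x y| <= 2 * eps * (z - y).
Proof.
move=> yz; apply: (le_trans (clamp_contraction (tilted_nd s x yz))).
have L : gam * (pert s x z - pert s x y) <= eps * (z - y).
  apply: (le_trans (ler_norm _)); rewrite normrM (ger0_norm gam_ge0).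
  apply: (le_trans (ler_wpM2l gam_ge0 (pert_lipschitz s x y z))).
  have -> : gam * (`|z - y| / width2 * M) = gam * M / width2 * `|z - y| by ring.
  by rewrite ger0_norm ?subr_ge0// ler_wpM2r ?subr_ge0.
have -> : tilted s x z - tilted s x y =
    eps * (z - y) + gam * (pert s x z - pert s x y) by rewrite /tilted; ring.
by rewrite -mulrA mulr_natl mulr2n lerD2l.
Qed.

Lemma hyp_cdf_right_continuous s x : right_continuous (hyp_cdf s x).
Proof.
move=> y; apply/cvgrPdist_le => e e0; near=> z.
have yz : y <= z by [].
rewrite distrC (le_trans (hyp_cdf_lipschitz s x yz))//.
rewrite -ler_pdivlMl ?mulr_gt0// lerBlDl; near: z.
by apply: nbhs_right_le; rewrite ltrDl mulr_gt0// invr_gt0 mulr_gt0.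
Unshelve. all: by end_near. Qed.

Lemma hyp_cdf_cond_cdf s : cond_cdf (hyp_cdf s).
Proof.
split=> [y|x].
  exact: (measurable_fun_pair1 y (measurable_hyp_cdf s)).
(* Past [b2] only the tilt remains, and past [eps^-1] it is at least 1. *)
apply: (@probability_of_cdf _ (hyp_cdf s x) (eps^-1 + b2)).
- move=> y z yz; apply: le_max2 => //; apply: le_min2 => //; exact: tilted_nd.
- exact: hyp_cdf_right_continuous.
- move=> y y0; rewrite /hyp_cdf tilted_off2; last first.
    by left; rewrite (le_trans y0)// ltW// mid_gt0.
  by rewrite max_l// ge_min pmulr_rle0// y0 orbT.
- move=> y yY; rewrite /hyp_cdf tilted_off2; last first.
    by right; rewrite (le_trans _ yY)// lerDr invr_ge0 ltW.
  rewrite min_l ?max_r// -ler_pdivrMl// mulr1 (le_trans _ yY)//.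
  by rewrite lerDl ltW// b2_gt0.
Qed.

(** * Membership in the Besov ball *)

Section BesovBound.
Variables (beta1 beta2 L : R).
Local Notation side := (Num.sqrt ((b1 - a1) * (b2 - a2))).
Hypothesis beta1_gt0 : 0 < beta1.
Hypothesis beta2_gt1 : 1 < beta2.
Hypothesis deg1 : (rB beta1 < deg)%N.
Hypothesis deg2 : (rB beta2 < deg)%N.
Hypothesis small1 : gam * (2 ^+ rB beta1 * M * width1 `^ (- beta1)) * side <= L / 4.
Hypothesis small2 : gam * (2 ^+ rB beta2 * M * width2 `^ (- beta2)) * side <= L / 4.
Hypothesis small3 : eps * b2 * side <= L / 2.
Local Notation A1 := `[a1, b1]%classic.
Local Notation A2 := `[a2, b2]%classic.

Let side_ge0 : 0 <= side. Proof. exact: sqrtr_ge0. Qed.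

Let beta_le_rB (b : R) : b <= (rB b)%:R.
Proof. exact/ltW/truncnS_gt. Qed.

Let in_A2 y : A2 y -> 0 <= y <= b2.
Proof. by rewrite /= in_itv/= => /andP[ay ->]; rewrite (le_trans a2_ge0). Qed.

Let shrink_sub (a b : R) r h : shrink `[a, b]%classic r h `<=` `[a, b]%classic.
Proof. by move=> x []. Qed.

(** All nodes of the difference lie between its two extreme ones, whatever the sign of [h]; hence
    [hyp_cdfE] applies at each of them. *)
Let shrink_between (a b x h : R) r (k : 'I_r.+1) :
  shrink `[a, b]%classic r h x -> `[a, b]%classic (x + k%:R * h).
Proof.
rewrite /shrink /= !in_itv/= => -[/andP[ax xb] /andP[ar rb]].
have kr : k%:R <= r%:R :> R by rewrite ler_nat -ltnS.
have k0 : 0 <= k%:R :> R by rewrite ler0n.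
have [h0|/ltW h0] := leP 0 h.
  have : k%:R * h <= r%:R * h by rewrite ler_wpM2r.
  have : 0 <= k%:R * h by rewrite mulr_ge0.
  by move=> ? ?; apply/andP; split; lra.
have : r%:R * h <= k%:R * h by rewrite ler_wnM2r.
have : k%:R * h <= 0 by rewrite mulr_ge0_le0.
by move=> ? ?; apply/andP; split; lra.
Qed.

Lemma omega1_hyp_cdf s t : 0 < t ->
  (omega1 A1 A2 (rB beta1) (hyp_cdf s) t <=
   (gam * (2 ^+ rB beta1 * M * width1 `^ (- beta1)) * side * t `^ beta1)%:E)%E.
Proof.
move=> t0; apply: ge_ereal_sup => _ [h /= ht <-].
rewrite mulrAC; apply: L2norm_bounded.
- exact: shrink_sub.
- by [].
- exact: ltW.
- exact: ltW.
- by rewrite !mulr_ge0 ?powR_ge0 ?exprn_ge0.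
move=> x y _ /in_A2 yA.
have -> : diff1 (rB beta1) h (hyp_cdf s) x y =
    fdiff (rB beta1) h (fun u => eps * y + gam * pert s u y) x.
  by apply: eq_bigr => k _; rewrite hyp_cdfE.
(* In the first direction the tilt is constant, and any order at least 1 removes it. *)
rewrite fdiffD fdiff_cst add0r fdiffZ normrM (ger0_norm gam_ge0) -!mulrA.
rewrite ler_wpM2l// !mulrA; apply: fdiff_pert1 => //; exact: ltW.
Qed.

Lemma omega2_hyp_cdf s t : 0 < t ->
  (omega2 A1 A2 (rB beta2) (hyp_cdf s) t <=
   (gam * (2 ^+ rB beta2 * M * width2 `^ (- beta2)) * side * t `^ beta2)%:E)%E.
Proof.
move=> t0; apply: ge_ereal_sup => _ [h /= ht <-].
rewrite mulrAC; apply: L2norm_bounded.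
- by [].
- exact: shrink_sub.
- exact: ltW.
- exact: ltW.
- by rewrite !mulr_ge0 ?powR_ge0 ?exprn_ge0.
move=> x y _ yA.
have -> : diff2 (rB beta2) h (hyp_cdf s) x y =
    fdiff (rB beta2) h (fun u => eps * u + gam * pert s x u) y.
  by apply: eq_bigr => k _; rewrite hyp_cdfE//; apply: in_A2; exact: shrink_between yA.
rewrite fdiffD.
(* As [beta2 > 1], the order [rB beta2] is at least 2 and removes the linear tilt. *)
have -> : fdiff (rB beta2) h (fun u => eps * u) y = 0.
  rewrite /rB; have : (0 < Num.truncn beta2)%N by rewrite truncn_gt0 ltW.
  by case: (Num.truncn beta2) => // r _; exact: fdiff_linear.
rewrite add0r fdiffZ normrM (ger0_norm gam_ge0) -!mulrA.
rewrite ler_wpM2l// !mulrA; apply: fdiff_pert2 => //.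
by rewrite ltW// (lt_trans _ beta2_gt1).
Qed.

(** The radius is shared out: [L / 4] for each direction of the seminorm, [L / 2] for the norm in
    [L^2(A)]. *)
Lemma besov_hyp_cdf s : besov_ball A1 A2 beta1 beta2 L (hyp_cdf s).
Proof.
rewrite /besov_ball /besov_norm.
have -> : L%:E = ((L / 2)%:E + (L / 2)%:E)%E by rewrite -EFinD -splitr.
apply: leeD; last first.
  apply: (@le_trans _ _ (eps * b2 * side)%:E); last by rewrite lee_fin.
  apply: L2norm_bounded => //; [exact: ltW|exact: ltW| |].
    exact: mulr_ge0 (ltW eps_gt0) (ltW b2_gt0).
  move=> x y _ /in_A2 yA; rewrite hyp_cdfE//.
  by have /andP[p0 pb] := tilted_0b2 s x yA; rewrite ger0_norm.
apply: ge_ereal_sup => _ [t /= t0 <-].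
have -> : (L / 2)%:E = ((L / 4)%:E + (L / 4)%:E)%E.
  by rewrite -EFinD; congr EFin; field.
have scale (b K : R) (om : \bar R) : (om <= (K * t `^ b)%:E)%E -> K <= L / 4 ->
    ((t `^ (- b))%:E * om <= (L / 4)%:E)%E.
  move=> omK KL; apply: (@le_trans _ _ ((t `^ (- b))%:E * (K * t `^ b)%:E)%E).
    by rewrite lee_wpmul2l// lee_fin powR_ge0.
  rewrite -EFinM lee_fin mulrCA powRN mulVf ?mulr1//.
  by rewrite gt_eqF// powR_gt0.
by apply: leeD; apply: scale; [exact: omega1_hyp_cdf|exact: small1
  |exact: omega2_hyp_cdf|exact: small2].
Qed.

End BesovBound.

(** * Neighbouring hypotheses and losses, cell by cell *)

Definition cell1 q : set R := [set x | 0 < coord1 q.1 x < 1].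
Definition cell2 q : set R := [set y | 0 < coord2 q.2 y < 1].

Lemma pert_flip s q x y :
  pert (flip q s) x y = pert s x y + ((~~ s q)%:R - (s q)%:R) * cell_bump q x y.
Proof.
rewrite /pert (bigD1 q)//= [in RHS](bigD1 q)//= ffunE eqxx addrAC; congr (_ + _).
  by ring.
by apply: eq_bigr => p pq; rewrite ffunE (negbTE pq).
Qed.

Lemma hyp_cdf_flip_off q s x y : ~ (cell1 q x /\ cell2 q y) ->
  hyp_cdf (flip q s) x y = hyp_cdf s x y.
Proof.
move=> off; rewrite /hyp_cdf /tilted pert_flip.
suff -> : cell_bump q x y = 0 by rewrite mulr0 addr0.
rewrite /cell_bump /cut; case: ifPn => [c1|_]; last by rewrite mul0r.
by case: ifPn => [c2|_]; [case: off|rewrite mulr0].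
Qed.

Lemma hyp_cdf_flip_close q s x y : cell1 q x -> cell2 q y ->
  `|hyp_cdf (flip q s) x y - hyp_cdf s x y| <= gam.
Proof.
move=> _ /coord2_bounds/andP[my yb].
have y0b : 0 <= y <= b2 by rewrite (ltW yb) andbT ltW// (lt_trans mid_gt0).
rewrite !hyp_cdfE// /tilted pert_flip.
have /andP[p0 p1] := bump_01 q x y.
have -> : eps * y + gam * (pert s x y + ((~~ s q)%:R - (s q)%:R) * cell_bump q x y) -
  (eps * y + gam * pert s x y) = gam * (((~~ s q)%:R - (s q)%:R) * cell_bump q x y) by ring.
rewrite normrM (ger0_norm gam_ge0) ler_piMr// normrM (ger0_norm p0).
by rewrite mulr_ile1//; case: (s q); rewrite ?sub0r ?subr0 ?normrN normr1.
Qed.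

(** On a cell the values lie between [eps * mid] and [eps * b2 <= 1 / 2]. *)
Lemma hyp_cdf_variance q s x y : cell1 q x -> cell2 q y ->
  eps * mid / 2 <= hyp_cdf s x y * (1 - hyp_cdf s x y).
Proof.
move=> _ /coord2_bounds/andP[my yb].
have y0b : 0 <= y <= b2 by rewrite (ltW yb) andbT ltW// (lt_trans mid_gt0).
rewrite hyp_cdfE//; have /andP[p0 pb] := tilted_0b2 s x y0b.
have lb : eps * mid <= tilted s x y.
  by apply: le_trans (tilted_nd s x (ltW my)); rewrite tilted_off2//; left.
apply: ler_pM => //; first exact: mulr_ge0 (ltW eps_gt0) (ltW mid_gt0).
by have := eps_le; lra.
Qed.

Lemma cell1E q : cell1 q = `]((q.1 : nat)%:R * width1 + a1),
  ((q.1 : nat).+1%:R * width1 + a1)[%classic.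
Proof.
apply/seteqP; split=> x; rewrite /cell1 /coord1 /= in_itv/=;
  by rewrite subr_gt0 ltr_pdivlMr ?width1_gt0// ltrBrDr ltrBlDl natr1
     ltr_pdivrMr ?width1_gt0// ltrBlDr.
Qed.

Lemma cell2E q : cell2 q = `]((q.2 : nat)%:R * width2 + mid),
  ((q.2 : nat).+1%:R * width2 + mid)[%classic.
Proof.
apply/seteqP; split=> x; rewrite /cell2 /coord2 /= in_itv/=;
  by rewrite subr_gt0 ltr_pdivlMr ?width2_gt0// ltrBrDr ltrBlDl natr1
     ltr_pdivrMr ?width2_gt0// ltrBlDr.
Qed.

Local Notation mu := (@lebesgue_measure R).

Lemma cell1_mass q : mu (cell1 q) = width1%:E.
Proof.
rewrite cell1E lebesgue_measure_itv/= lte_fin -natr1 ltrD2r ltr_pM2r ?width1_gt0//.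
by rewrite ltrDl ltr01 -EFinB; congr EFin; ring.
Qed.

Lemma cell2_mass q : mu (cell2 q) = width2%:E.
Proof.
rewrite cell2E lebesgue_measure_itv/= lte_fin -natr1 ltrD2r ltr_pM2r ?width2_gt0//.
by rewrite ltrDl ltr01 -EFinB; congr EFin; ring.
Qed.

Lemma measurable_cell1 q : measurable (cell1 q).
Proof. by rewrite cell1E; exact: measurable_itv. Qed.

Lemma measurable_cell2 q : measurable (cell2 q).
Proof. by rewrite cell2E; exact: measurable_itv. Qed.

(** The middle half of a cell side: there [u * (1 - u)] is at least [3 / 16], which bounds the bump
    from below. *)
Definition core1 q : set R := [set x | 4^-1 < coord1 q.1 x < 3 / 4].
Definition core2 q : set R := [set y | 4^-1 < coord2 q.2 y < 3 / 4].
(** On the core of [q] this is the value of [hyp_cdf s] for every [s] with [s q = b], so that the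
    loss there depends on [s] through one bit only. *)
Definition local_value (b : bool) q (x y : R) : R :=
  eps * y + gam * (b%:R * cell_bump q x y).
Definition core_ind q (x y : R) : R := \1_(core1 q) x * \1_(core2 q) y.
Definition loss_density (b : bool) q (f : R -> R -> R) (x y : R) : \bar R :=
  (core_ind q x y * (f x y - local_value b q x y) ^+ 2)%:E.
Definition loss (b : bool) q (f : R -> R -> R) : \bar R :=
  (\int[mu]_x \int[mu]_y loss_density b q f x y)%E.
(** Half the squared gap of the two local values, bounded below on the core, times the area of the
    core. *)
Definition separation : R :=
  gam ^+ 2 * (3 / 16) ^+ deg ^+ 4 / 2 * (width1 / 2) * (width2 / 2).

Lemma core1_cell q x : core1 q x -> 0 < coord1 q.1 x < 1.
Proof. by rewrite /core1/= => /andP[? ?]; apply/andP; split; lra. Qed.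

Lemma core2_cell q y : core2 q y -> 0 < coord2 q.2 y < 1.
Proof. by rewrite /core2/= => /andP[? ?]; apply/andP; split; lra. Qed.

Let itvE (c w : R) (j : nat) (p r : R) : 0 < w ->
  [set x : R | p < (x - c) / w - j%:R < r] =
  `]((j%:R + p) * w + c), ((j%:R + r) * w + c)[%classic.
Proof.
move=> w0; apply/seteqP; split=> x; rewrite /= in_itv/=;
  by rewrite ltrBrDl ltrBlDl ltr_pdivlMr// ltr_pdivrMr// ltrBrDr ltrBlDr.
Qed.

Let itv_mass (c w : R) (j : nat) (p r : R) : 0 < w -> p < r ->
  mu `]((j%:R + p) * w + c), ((j%:R + r) * w + c)[%classic = ((r - p) * w)%:E.
Proof.
move=> w0 pr; rewrite lebesgue_measure_itv/= lte_fin ltrD2r ltr_pM2r// ltrD2l pr.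
by rewrite -EFinB; congr EFin; ring.
Qed.

Lemma measurable_core1 q : measurable (core1 q).
Proof. by rewrite /core1 /coord1 itvE ?width1_gt0//; exact: measurable_itv. Qed.

Lemma measurable_core2 q : measurable (core2 q).
Proof. by rewrite /core2 /coord2 itvE ?width2_gt0//; exact: measurable_itv. Qed.

Lemma core1_mass q : mu (core1 q) = (width1 / 2)%:E.
Proof.
rewrite /core1 /coord1 itvE ?width1_gt0// itv_mass ?width1_gt0//; last lra.
by congr EFin; field.
Qed.

Lemma core2_mass q : mu (core2 q) = (width2 / 2)%:E.
Proof.
rewrite /core2 /coord2 itvE ?width2_gt0// itv_mass ?width2_gt0//; last lra.
by congr EFin; field.
Qed.

Lemma bump_core q x y : core1 q x -> core2 q y -> (3 / 16) ^+ deg ^+ 2 <= cell_bump q x y.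
Proof.
have H u : 4^-1 < u < 3 / 4 -> (3 / 16) ^+ deg <= cut psi u.
  move=> /andP[u0 u1]; rewrite /cut; case: ifPn => [_|/negP[]]; last first.
    by apply/andP; split; lra.
  rewrite horner_exp bumpXE lerXn2r ?nnegrE//; try nra.
move=> c1 c2; rewrite expr2 /cell_bump ler_pM ?exprn_ge0//; exact: H.
Qed.

Lemma bump_other_cell p q x y : p != q ->
  0 < coord1 q.1 x < 1 -> 0 < coord2 q.2 y < 1 -> cell_bump p x y = 0.
Proof.
move=> pq xq yq; rewrite /cell_bump.
have [p1|p1] := eqVneq (p.1 : nat) (q.1 : nat); last first.
  by rewrite (cut_shift_eq0 psi xq p1) mul0r.
have [p2|p2] := eqVneq (p.2 : nat) (q.2 : nat); last first.
  by rewrite (cut_shift_eq0 psi yq p2) mulr0.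
case/eqP: pq; case: p q {xq yq} p1 p2 => [j k] [j' k'] /= /val_inj -> /val_inj ->.
by [].
Qed.

Lemma hyp_cdf_core s q x y : core1 q x -> core2 q y ->
  hyp_cdf s x y = local_value (s q) q x y.
Proof.
move=> /core1_cell c1 /core2_cell c2.
have /andP[my yb] := coord2_bounds c2.
have y0b : 0 <= y <= b2 by rewrite (ltW yb) andbT ltW// (lt_trans mid_gt0).
rewrite hyp_cdfE// /tilted /local_value /pert (bigD1 q)//= big1 ?addr0//.
by move=> p pq; rewrite (bump_other_cell pq c1 c2) mulr0.
Qed.

Lemma core_ind_ge0 q x y : 0 <= core_ind q x y.
Proof. by rewrite /core_ind !indicE mulr_ge0. Qed.

Lemma core_ind_off q x y : ~ (core1 q x /\ core2 q y) -> core_ind q x y = 0.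
Proof.
move=> off; rewrite /core_ind !indicE.
have [/set_mem c1|_] := boolP (x \in core1 q); last by rewrite mul0r.
have [/set_mem c2|_] := boolP (y \in core2 q); last by rewrite mulr0.
by case: off.
Qed.

Lemma core_ind_on q x y : core1 q x -> core2 q y -> core_ind q x y = 1.
Proof. by move=> c1 c2; rewrite /core_ind !indicE !mem_set// mulr1. Qed.

Lemma loss_density_ge0 b q f x y : (0 <= loss_density b q f x y)%E.
Proof. by rewrite lee_fin mulr_ge0 ?sqr_ge0 ?core_ind_ge0. Qed.

Lemma loss_ge0 b q f : (0 <= loss b q f)%E.
Proof.
by apply: integral_ge0 => x _; apply: integral_ge0 => y _; exact: loss_density_ge0.
Qed.

Lemma measurable_core_ind q :
  measurable_fun setT (fun p : R * R => core_ind q p.1 p.2).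
Proof.
apply: measurable_funM.
  by apply: (measurableT_comp (measurable_indic (measurable_core1 q))).
by apply: (measurableT_comp (measurable_indic (measurable_core2 q))).
Qed.

Lemma measurable_local_value b q :
  measurable_fun setT (fun p : R * R => local_value b q p.1 p.2).
Proof.
apply: measurable_funD; first by apply: measurable_funM.
by do 2!apply: measurable_funM => //; exact: measurable_bump.
Qed.

Lemma measurable_loss_density d (T : measurableType d) b q (f : T -> R -> R -> R) :
  measurable_fun setT (fun p : T * (R * R) => f p.1 p.2.1 p.2.2) ->
  measurable_fun setT (fun p : T * (R * R) => loss_density b q (f p.1) p.2.1 p.2.2).
Proof.
move=> mf; apply/measurable_EFinP; apply: measurable_funM.
  by apply: (measurableT_comp (measurable_core_ind q)); exact: measurable_snd.
apply: measurable_funX; apply: measurable_funB => //.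
by apply: (measurableT_comp (measurable_local_value b q)); exact: measurable_snd.
Qed.

Lemma measurable_loss d (T : measurableType d) b q (f : T -> R -> R -> R) :
  measurable_fun setT (fun p : T * (R * R) => f p.1 p.2.1 p.2.2) ->
  measurable_fun setT (fun z => loss b q (f z)).
Proof.
move=> /(measurable_loss_density b q) mf.
pose H (p : (T * R) * R) := loss_density b q (f p.1.1) p.1.2 p.2.
have mc : measurable_fun setT (fun p : (T * R) * R => (p.1.1, (p.1.2, p.2))).
  by repeat apply: measurable_fun_pair => //; apply: measurableT_comp.
have mH : measurable_fun setT H by exact: (measurableT_comp mf mc).
have mI := measurable_fun_fubini_tonelli_F (m2 := mu) H mH
  (fun p => loss_density_ge0 b q (f p.1.1) p.1.2 p.2).
apply: (measurable_fun_fubini_tonelli_F (m2 := mu) _ mI) => p.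
by apply: integral_ge0 => y _; exact: loss_density_ge0.
Qed.

Section FixedEstimate.
Variable f : R -> R -> R.
Hypothesis mf : measurable_fun setT (fun p : R * R => f p.1 p.2).

Let mdens b q : measurable_fun setT (fun p : R * R => loss_density b q f p.1 p.2).
Proof.
have mF : measurable_fun setT (fun p : R * (R * R) => f p.2.1 p.2.2).
  by apply: (measurableT_comp mf); exact: measurable_snd.
have mc : measurable_fun setT (fun p : R * R => (0 : R, p)).
  exact: measurable_fun_pair.
exact: (measurableT_comp
  (measurable_loss_density b q (f := fun _ : R => f) mF) mc).
Qed.

Let mdens2 b q x : measurable_fun setT (loss_density b q f x).
Proof. exact: (measurable_fun_pair2 x (mdens b q)). Qed.

Let mdens1 b q : measurable_fun setT (fun x => \int[mu]_y loss_density b q f x y)%E.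
Proof.
apply: (measurable_fun_fubini_tonelli_F (m2 := mu)
  (fun p : R * R => loss_density b q f p.1 p.2) (mdens b q)) => p.
exact: loss_density_ge0.
Qed.

Let dens1_ge0 b q x : (0 <= \int[mu]_y loss_density b q f x y)%E.
Proof. by apply: integral_ge0 => y _; exact: loss_density_ge0. Qed.

(** The cores are disjoint and lie in [A], so that at most one local density is nonzero at a point,
    where it equals the squared error. *)
Lemma loss_sum_le s :
  (\sum_q loss (s q) q f <=
   L2sq `[a1, b1]%classic `[a2, b2]%classic (fun x y => (f x y - hyp_cdf s x y)%R))%E.
Proof.
have dens0 q x y : core1 q x /\ core2 q y \/ loss_density (s q) q f x y = 0%E.
  have [?|off] := pselect (core1 q x /\ core2 q y); first by left.
  by right; rewrite /loss_density core_ind_off// mul0r.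
have -> : (\sum_q loss (s q) q f =
    \int[mu]_x \int[mu]_y \sum_q loss_density (s q) q f x y)%E.
  transitivity (\int[mu]_x \sum_q \int[mu]_y loss_density (s q) q f x y)%E.
    rewrite ge0_integral_sum => [//|//|q|q x _]; [exact: mdens1|exact: dens1_ge0].
  apply: eq_integral => x _.
  rewrite ge0_integral_sum => [//|//|q|q y _]; [exact: mdens2|].
  exact: loss_density_ge0.
apply: le_L2sq => [x y|x y _ _|x y off].
- by apply: sume_ge0 => q _; exact: loss_density_ge0.
- have [[q [c1 c2]]|none] := pselect (exists q, core1 q x /\ core2 q y).
    rewrite (bigD1 q)//= big1 ?adde0 => [|p pq].
      by rewrite /loss_density core_ind_on// mul1r (hyp_cdf_core s c1 c2).
    (* In a second core the bump of [p] would be positive by [bump_core], although it vanishes on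
       the cell of [q]. *)
    have [[d1 d2]|//] := dens0 p x y.
    have p0 := bump_other_cell pq (core1_cell c1) (core2_cell c2).
    have := bump_core d1 d2; rewrite p0 leNgt.
    by rewrite exprn_gt0// exprn_gt0//; lra.
  rewrite big1 => [|q _]; first by rewrite lee_fin sqr_ge0.
  by have [cq|//] := dens0 q x y; case: none; exists q.
- rewrite big1// => q _; have [[c1 c2]|//] := dens0 q x y; case: off.
  have /andP[my yb] := coord2_bounds (core2_cell c2).
  split; rewrite /= in_itv/=; last by rewrite (ltW yb) (le_trans mid_ge (ltW my)).
  move: (core1_cell c1); rewrite /coord1 => /andP[x0 x1].
  have xw : 0 < (x - a1) / width1.
    by apply: (le_lt_trans (ler0n R q.1)); rewrite -subr_gt0.
  have ax : 0 < x - a1 by rewrite -(pmulr_lgt0 _ (_ : 0 < width1^-1)) ?invr_gt0 ?width1_gt0.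
  rewrite -subr_ge0 (ltW ax)/=.
  have : (x - a1) / width1 <= m1%:R.
    rewrite (@le_trans _ _ (q.1 : nat).+1%:R)//; last by rewrite ler_nat.
    by rewrite -natr1 -lerBlDl ltW.
  rewrite ler_pdivrMr ?width1_gt0// /width1 mulrCA mulfV ?mulr1 ?lerD2r//.
  by rewrite pnatr_eq0 -lt0n.
Qed.

Lemma loss_separated b q : (separation%:E <= loss b q f + loss (~~ b) q f)%E.
Proof.
pose K := gam ^+ 2 * (3 / 16) ^+ deg ^+ 4 / 2.
have K0 : 0 <= K by rewrite divr_ge0// mulr_ge0 ?sqr_ge0// exprn_ge0// exprn_ge0//; lra.
rewrite /loss -ge0_integralD; [|exact: measurableT
  |by move=> x _; exact: dens1_ge0|exact: mdens1
  |by move=> x _; exact: dens1_ge0|exact: mdens1].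
apply: (@le_trans _ _ (\int[mu]_x \int[mu]_y (K * core_ind q x y)%:E)%E); last first.
  apply: ge0_le_integral_dom => // [x _|x _|x _].
  - by apply: integral_ge0 => y _; rewrite lee_fin mulr_ge0 ?core_ind_ge0.
  - by apply: adde_ge0; exact: dens1_ge0.
  rewrite -ge0_integralD; [|exact: measurableT
    |by move=> y _; exact: loss_density_ge0|exact: mdens2
    |by move=> y _; exact: loss_density_ge0|exact: mdens2].
  apply: ge0_le_integral_dom => // [y _|y _|y _].
  - by rewrite lee_fin mulr_ge0 ?core_ind_ge0.
  - by apply: adde_ge0; exact: loss_density_ge0.
  rewrite -EFinD lee_fin -mulrDr mulrC.
  have [[c1 c2]|off] := pselect (core1 q x /\ core2 q y); last first.
    by rewrite core_ind_off// !mul0r.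
  rewrite core_ind_on// !mul1r /K.
  have B := bump_core c1 c2; have c0 : 0 <= (3 / 16 : R) ^+ deg.
    by rewrite exprn_ge0//; lra.
  have B4 : (3 / 16) ^+ deg ^+ 4 <= cell_bump q x y ^+ 2.
    by rewrite (exprM _ 2 2) lerXn2r ?nnegrE ?exprn_ge0// (le_trans _ B)// exprn_ge0.
  apply: (@le_trans _ _ (gam ^+ 2 * cell_bump q x y ^+ 2 / 2)).
    by rewrite ler_wpM2r// ler_wpM2l ?sqr_ge0.
  rewrite /local_value; set e := eps * y; set v := cell_bump q x y; set g := f x y.
  rewrite -subr_ge0.
  (* The sum of the squared distances from [g] to the two values is twice this square plus
     [(gam * v) ^+ 2 / 2]. *)
  have := sqr_ge0 (g - e - gam * v / 2).
  by case: b => /=; rewrite mul1r mul0r mulr0 addr0 => ?; nra.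
have inner x : (\int[mu]_y (K * core_ind q x y)%:E =
    (K * (width2 / 2))%:E * (\1_(core1 q) x)%:E)%E.
  under eq_integral do rewrite /core_ind mulrA EFinM.
  rewrite ge0_integralZl_EFin//.
  - rewrite integral_indic//; last exact: measurable_core2.
    rewrite setIT [X in (_ * X)%E](_ : _ = (width2 / 2)%:E); last exact: core2_mass.
    by rewrite -!EFinM; congr EFin; ring.
  - by apply/measurable_EFinP; exact: measurable_indic (measurable_core2 q).
  - by rewrite mulr_ge0// indicE.
under eq_integral do rewrite inner.
rewrite ge0_integralZl_EFin//.
- rewrite integral_indic//; last exact: measurable_core1.
  rewrite setIT [X in (_ * X)%E](_ : _ = (width1 / 2)%:E); last exact: core1_mass.
  by rewrite -EFinM lee_fin /separation -/K mulrAC.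
- by apply/measurable_EFinP; exact: measurable_indic (measurable_core1 q).
- by rewrite mulr_ge0// divr_ge0// ltW// width2_gt0.
Qed.

End FixedEstimate.

Lemma hypercube_risk (fd : R * R -> R) (h1 C : R) n (est : sample R n -> R -> R -> R) :
  design_density fd -> (forall p, fd p <= h1) -> estimator est -> 0 <= C ->
  (1 + h1 * gam ^+ 2 / (eps * mid / 2) * width1 * width2) ^+ n.+1 <= 2 ->
  exists s, ((C * (m1%:R * m2%:R * (separation / 4)))%:E <=
    sampleInt (hyp_cdf s) fd (fun z => C%:E * L2sq `[a1, b1]%classic `[a2, b2]%classic
      (fun x y => (est z x y - hyp_cdf s x y)%R)))%E.
Proof.
move=> dfd fdh mest C0 kap2.
have [mfd [fd0 _]] := dfd.
have mslice z : measurable_fun setT (fun p : R * R => est z p.1 p.2).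
  exact: (measurable_fun_pair2 z mest).
pose S s q := sampleInt (hyp_cdf s) fd (fun z => loss (s q) q (est z)).
have S0 s q : (0 <= S s q)%E.
  apply: sampleInt_ge0 => //; [exact: hyp_cdf_01|by move=> z; exact: loss_ge0].
have sep0 : 0 <= separation.
  rewrite /separation; have := width1_gt0; have := width2_gt0.
  move=> w2 w1; apply: mulr_ge0; last by rewrite divr_ge0// ltW.
  apply: mulr_ge0; last by rewrite divr_ge0// ltW.
  by rewrite divr_ge0// mulr_ge0 ?sqr_ge0// exprn_ge0// exprn_ge0//; lra.
have [|s Ss] := @cube_average R cell S (separation / 4) S0.
  (* The two-point bound gives [separation / 2] for each edge, that is [separation / 4] for each
     vertex on average. *)
  move=> s q; have -> : separation / 4 + separation / 4 = separation / 2 by field.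
  rewrite /S [in X in (_ + X)%E]/flip ffunE eqxx.
  (* The two laws are compared on the whole cell, of area [width1 * width2], while the loss is
     measured on its core. *)
  apply: (two_point_bound (measurable_hyp_cdf s) (hyp_cdf_01 s)
    (measurable_hyp_cdf (flip q s)) (hyp_cdf_01 (flip q s)) dfd fdh
    (measurable_cell1 q) (measurable_cell2 q) _
    (@hyp_cdf_flip_off q s) (@hyp_cdf_variance q s) (@hyp_cdf_flip_close q s)
    (cell1_mass q) (cell2_mass q)) => //.
  - by rewrite divr_gt0// mulr_gt0// mid_gt0.
  - exact: measurable_loss.
  - exact: measurable_loss.
  - by move=> z; exact: loss_ge0.
  - by move=> z; exact: loss_ge0.
  - by move=> z; exact: loss_separated.
exists s.
have l01 := hyp_cdf_01 s; have mF := measurable_hyp_cdf s.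
have ml q : measurable_fun setT (fun z => loss (s q) q (est z)).
  exact: measurable_loss.
have suml0 z : (0 <= \sum_q loss (s q) q (est z))%E.
  by apply: sume_ge0 => q _; exact: loss_ge0.
apply: (@le_trans _ _ (sampleInt (hyp_cdf s) fd
    (fun z => C%:E * \sum_q loss (s q) q (est z)))%E); last first.
  apply: le_sampleInt => // z; first by rewrite mule_ge0.
  by rewrite lee_wpmul2l//; exact: loss_sum_le.
rewrite sampleIntZ//; last exact: emeasurable_sum.
rewrite EFinM lee_wpmul2l//.
apply: le_trans (sampleInt_sum mF l01 mfd fd0 _ ml _); last first.
  by move=> q z; exact: loss_ge0.
by apply: le_trans Ss; rewrite card_prod !card_ord natrM.
Qed.

End Hypercube.

(** * Choice of the scales *)

Section Scales.
Context {R : realType}.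

(* [m1] and [m2] are the numbers of cells and [rho] is the amplitude, so that
   [n * rho ^ 2] is of the order of the number of cells. *)
Lemma balanced_scales (beta1 beta2 : R) (n : nat) :
  0 < beta1 -> 1 < beta2 -> (0 < n)%N ->
  let betabar := 2 * beta1 * beta2 / (beta1 + beta2) in
  exists m1 m2 : nat, exists2 rho : R, 0 < rho &
  [/\ (0 < m1)%N, (0 < m2)%N,
      rho * m1%:R `^ beta1 <= 1 & rho * m2%:R `^ beta2 <= 1] /\
  [/\ rho * m2%:R <= 1, n%:R * rho ^+ 2 <= 4 * (m1%:R * m2%:R)
    & n%:R `^ (betabar / (betabar + 1)) * rho ^+ 2 = 1].
Proof.
move=> be1 be2 n0 betabar.
have be2' : 0 < beta2 by exact: lt_trans be2.
have bb0 : 0 < betabar by rewrite divr_gt0 ?addr_gt0// !mulr_gt0.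
set s := betabar / (betabar + 1).
have s0 : 0 < s by rewrite divr_gt0 ?addr_gt0.
have n1 : 1 <= n%:R :> R by rewrite ler1n.
have npos : 0 < n%:R :> R by rewrite ltr0n.
have nD x y : n%:R `^ (x + y) = n%:R `^ x * n%:R `^ y :> R.
  by rewrite powRD// (gt_eqF npos) implybT.
have cells b : 0 < b -> exists m : nat, [/\ (0 < m)%N,
    m%:R <= n%:R `^ (s / (2 * b)) & n%:R `^ (s / (2 * b)) <= 2 * m%:R :> R].
  move=> b0; have N1 : 1 <= n%:R `^ (s / (2 * b)) :> R.
    rewrite -[leLHS](powRr0 n%:R); apply: ler_powR => //.
    by apply: divr_ge0; [exact: ltW|apply: mulr_ge0 => //; exact: ltW].
  have N0 := le_trans ler01 N1.
  have m0 : (0 < Num.truncn (n%:R `^ (s / (2 * b)) : R))%N by rewrite truncn_gt0.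
  exists (Num.truncn (n%:R `^ (s / (2 * b)) : R)); split=> //.
    by have /andP[] := truncn_itv N0.
  have /andP[_ /ltW/le_trans] := truncn_itv N0; apply.
  (* Rounding down a number at least 1 costs at most a factor 2; two directions give the factor 4 of
     the conclusion. *)
  by move: m0; set m := Num.truncn _; rewrite -(ler1n R) -natr1; lra.
have [m1 [m10 m1N N1m]] := cells _ be1.
have [m2 [m20 m2N N2m]] := cells _ be2'.
exists m1, m2, (n%:R `^ (- (s / 2))); first exact: powR_gt0.
have unit b m : 0 < b -> m%:R <= n%:R `^ (s / (2 * b)) ->
    n%:R `^ (- (s / 2)) * m%:R `^ b <= 1 :> R.
  move=> b0 mN; apply: (@le_trans _ _ (n%:R `^ (- (s / 2)) * n%:R `^ (s / (2 * b)) `^ b)).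
    by rewrite ler_wpM2l ?powR_ge0// ge0_ler_powR ?nnegrE ?powR_ge0// ltW.
  rewrite -powRrM -nD; have -> : - (s / 2) + s / (2 * b) * b = 0 :> R.
    by field; rewrite gt_eqF.
  by rewrite powRr0.
have sq : (n%:R `^ (- (s / 2))) ^+ 2 = n%:R `^ (- s) :> R.
  by rewrite expr2 -nD; congr (_ `^ _); field.
split; split=> //; [exact: unit|exact: unit| | |].
- apply: (@le_trans _ _ (n%:R `^ (- (s / 2)) * n%:R `^ (s / (2 * beta2)))).
    by rewrite ler_wpM2l ?powR_ge0.
  (* As [beta2 > 1], [s / (2 * beta2) <= s / 2]. *)
  rewrite -nD -[leRHS](powRr0 n%:R) ler_powR// -lerBrDl sub0r opprK.
  rewrite invfM mulrA ler_pdivrMr// ler_peMr ?ltW// divr_gt0//.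
- rewrite sq -[X in X * _]powRr1 ?ler0n// -nD.
  apply: (@le_trans _ _ (n%:R `^ (s / (2 * beta1)) * n%:R `^ (s / (2 * beta2)))).
    (* Since [1 / beta1 + 1 / beta2 = 2 / betabar], the exponents add up to
       [s / betabar = 1 - s]. *)
    rewrite -nD le_eqVlt; apply/orP; left; apply/eqP; congr (_ `^ _).
    rewrite /s /betabar; field.
    by rewrite !gt_eqF ?addr_gt0 ?mulr_gt0.
  have -> : 4 * (m1%:R * m2%:R) = (2 * m1%:R) * (2 * m2%:R) :> R by ring.
  by rewrite ler_pM ?powR_ge0.
- by rewrite sq -nD subrr powRr0.
Qed.

Lemma expr1D_le2 (x : R) n : 0 <= x -> n%:R * x <= ln 2 -> (1 + x) ^+ n <= 2.
Proof.
move=> x0 nx; rewrite -[leRHS](@lnK _ 2) ?posrE//.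
apply: (@le_trans _ _ (expR x ^+ n)).
  by rewrite lerXn2r ?nnegrE ?addr_ge0 ?expR_ge0 ?expR_ge1Dx.
by rewrite -expRM_natl ler_expR.
Qed.

Lemma powRN_div (W b : R) (m : nat) : 0 < W -> (0 < m)%N ->
  (W / m%:R) `^ (- b) = W `^ (- b) * m%:R `^ b.
Proof.
move=> W0 m0; rewrite powRM ?invr_ge0 ?(ltW W0)//.
by rewrite -[m%:R^-1]powR_inv1// -powRrM mulN1r opprK.
Qed.

End Scales.

(** * Choice of the constants and assembly of the lower bound *)

Unset Implicit Arguments.

Theorem theorem3 (R : realType) (a1 b1 a2 b2 : R) (beta1 beta2 L h1 : R) :
  a1 < b1 -> 0 <= a2 -> a2 < b2 ->
  0 < beta1 -> 1 < beta2 -> 0 < L -> 0 < h1 ->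
  let A1 := `[a1, b1]%classic in
  let A2 := `[a2, b2]%classic in
  let betabar := 2 * beta1 * beta2 / (beta1 + beta2) in
  exists c : R, 0 < c /\
  forall fd : R * R -> R, design_density fd -> (forall p, fd p <= h1) ->
  exists n0 : nat, (0 < n0)%N /\
  forall n : nat, (n0 <= n)%N ->
  forall est : sample R n.-1 -> R -> R -> R, estimator est ->
  (c%:E <= ereal_sup [set risk A1 A2 fd (betabar / (betabar + 1)) est F
                     | F in [set F | cond_cdf F /\ besov_ball A1 A2 beta1 beta2 L F]])%E.
Proof.
move=> ab1 a20 ab2 be1 be2 L0 h10 A1 A2 betabar.
(* The exponent exceeds both difference orders, so that the bumps have enough derivatives. *)
pose deg := (maxn (rB beta1) (rB beta2)).+1.
have deg1 : (rB beta1 < deg)%N by rewrite ltnS leq_maxl.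
have deg2 : (rB beta2 < deg)%N by rewrite ltnS leq_maxr.
have deg_gt1 : (1 < deg)%N by exact: leq_ltn_trans deg1.
have [M M1 dM] := bumpX_derivn_bounded R deg.
have M0 : 0 < M by exact: lt_le_trans M1.
have b20 : 0 < b2 by exact: le_lt_trans ab2.
pose W1 := b1 - a1; pose W2 := b2 - mid a2 b2.
have W10 : 0 < W1 by rewrite subr_gt0.
have W20 : 0 < W2 by rewrite subr_gt0 mid_lt.
have mid0 : 0 < mid a2 b2 by exact: mid_gt0.
pose S := Num.sqrt ((b1 - a1) * (b2 - a2)).
have S0 : 0 <= S by exact: sqrtr_ge0.
(* The first bound keeps the tilt below [1 / 2] on [A], the second its norm in [L^2(A)] below
   [L / 2]. *)
pose eps := Num.min ((2 * b2)^-1) (L / (2 * b2 * (S + 1))).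
have S1 : 0 < S + 1 by rewrite ltr_wpDl.
have eps0 : 0 < eps by rewrite lt_min invr_gt0 divr_gt0 ?mulr_gt0.
have eps1 : eps * b2 <= 1 / 2.
  have e1 : eps <= (2 * b2)^-1 by rewrite ge_min lexx.
  apply: (le_trans (ler_wpM2r (ltW b20) e1)).
  by rewrite le_eqVlt; apply/orP; left; apply/eqP; field; rewrite gt_eqF.
have eps2 : eps * b2 * S <= L / 2.
  have e2 : eps <= L / (2 * b2 * (S + 1)) by rewrite ge_min lexx orbT.
  apply: (@le_trans _ _ (eps * b2 * (S + 1))).
    by rewrite ler_wpM2l ?lerDl// mulr_ge0// ltW.
  rewrite -mulrA; apply: (le_trans (ler_wpM2r (ltW (mulr_gt0 b20 S1)) e2)).
  by rewrite le_eqVlt; apply/orP; left; apply/eqP; field; rewrite !gt_eqF.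
pose K1 := 2 ^+ rB beta1 * M * W1 `^ (- beta1) * S.
pose K2 := 2 ^+ rB beta2 * M * W2 `^ (- beta2) * S.
(* The chi-square constant: 8 is the 2 of the variance bound [eps * mid / 2] times the 4 of
   [balanced_scales]. *)
pose Q := 8 * h1 * W1 * W2 / (eps * mid a2 b2).
have K10 : 0 <= K1.
  by rewrite /K1 mulr_ge0// mulr_ge0 ?powR_ge0// mulr_ge0 ?exprn_ge0// ltW.
have K20 : 0 <= K2.
  by rewrite /K2 mulr_ge0// mulr_ge0 ?powR_ge0// mulr_ge0 ?exprn_ge0// ltW.
have Q0 : 0 < Q by rewrite (divr_gt0 _ (mulr_gt0 eps0 mid0))// !mulr_gt0.
have MW0 : 0 < M / W2 by rewrite divr_gt0.
pose B := Num.min (Num.min eps (L / 4)) (Num.min (ln 2) 1).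
have B0 : 0 < B.
  rewrite /B; move: (eps) eps0 => e e0.
  by rewrite !lt_min e0 ln_gt0 ?ltr1n// ltr01 divr_gt0.
have K0 : 0 < M / W2 + K1 + K2 + Q + 1 by lra.
(* One factor meets all constraints (slope, both Besov bounds, chi-square, [c1 <= 1]): times any
   single constant of the denominator it is at most [B]. *)
pose c1 := B / (M / W2 + K1 + K2 + Q + 1).
have c10 : 0 < c1 by rewrite divr_gt0.
have c1B X : 0 <= X -> X <= M / W2 + K1 + K2 + Q + 1 -> c1 * X <= B.
  move=> X0 XK; rewrite /c1 mulrAC ler_pdivrMr// ler_wpM2l// ltW//.
have [Beps BL Bln B1] : [/\ B <= eps, B <= L / 4, B <= ln 2 & B <= 1].
  by rewrite /B; move: (eps) => e; split; rewrite !ge_min lexx ?orbT.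
(* This is the normalized [m1 * m2 * separation / 4] for [gam = c1 * rho]: the numbers of cells
   cancel against the widths, and the rate against [rho ^+ 2]. The choice precedes [fd]. *)
exists (c1 ^+ 2 * ((3 / 16) ^+ deg ^+ 4 / 2 * (W1 / 2) * (W2 / 2) / 4)).
split.
  have q0 : 0 < (3 / 16) ^+ deg ^+ 4 :> R by do 2!apply: exprn_gt0; lra.
  apply: mulr_gt0; first exact: exprn_gt0.
  by do ![apply: divr_gt0 => // | apply: mulr_gt0].
(* The scales exist for every positive [n], so the bound holds from the first observation on. *)
move=> fd dfd fdh; exists 1%N; split=> // n n0 est mest.
have [m1 [m2 [rho rho0 [[m10 m20 r1 r2] [r3 r4 r5]]]]] :=
  balanced_scales be1 be2 n0.
pose gam := c1 * rho.
have gam0 : 0 <= gam by rewrite mulr_ge0 ?ltW.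
have m1R : 0 < m1%:R :> R by rewrite ltr0n.
have m2R : 0 < m2%:R :> R by rewrite ltr0n.
have gam1 : gam * M / width2 a2 b2 m2 <= eps.
  apply: le_trans Beps; rewrite /width2 -/W2.
  have -> : gam * M / (W2 / m2%:R) = c1 * (M / W2) * (rho * m2%:R).
    by rewrite /gam; field; rewrite !gt_eqF.
  have cM : c1 * (M / W2) <= B by apply: c1B; lra.
  by apply: le_trans cM; apply: ler_piMr => //; exact: mulr_ge0 (ltW c10) (ltW MW0).
have gam2 : gam * (2 ^+ rB beta1 * M * width1 a1 b1 m1 `^ (- beta1)) * S <= L / 4.
  apply: le_trans BL; rewrite /width1 -/W1 powRN_div//.
  have -> : gam * (2 ^+ rB beta1 * M * (W1 `^ (- beta1) * m1%:R `^ beta1)) * S =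
     c1 * K1 * (rho * m1%:R `^ beta1) by rewrite /gam /K1; ring.
  have cM : c1 * K1 <= B by apply: c1B; lra.
  by apply: le_trans cM; apply: ler_piMr => //; exact: mulr_ge0 (ltW c10) K10.
have gam3 : gam * (2 ^+ rB beta2 * M * width2 a2 b2 m2 `^ (- beta2)) * S <= L / 4.
  apply: le_trans BL; rewrite /width2 -/W2 powRN_div//.
  have -> : gam * (2 ^+ rB beta2 * M * (W2 `^ (- beta2) * m2%:R `^ beta2)) * S =
     c1 * K2 * (rho * m2%:R `^ beta2) by rewrite /gam /K2; ring.
  have cM : c1 * K2 <= B by apply: c1B; lra.
  by apply: le_trans cM; apply: ler_piMr => //; exact: mulr_ge0 (ltW c10) K20.
have chi2 : (1 + h1 * gam ^+ 2 / (eps * mid a2 b2 / 2) * width1 a1 b1 m1 *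
    width2 a2 b2 m2) ^+ n.-1.+1 <= 2.
  (* [sample R n.-1] holds [n] observations. *)
  rewrite prednK//.
  have -> : h1 * gam ^+ 2 / (eps * mid a2 b2 / 2) * width1 a1 b1 m1 * width2 a2 b2 m2
      = c1 ^+ 2 * Q * (rho ^+ 2 / (4 * (m1%:R * m2%:R))).
    rewrite /gam /Q /width1 /width2 -/W1 -/W2; field.
    by rewrite !gt_eqF.
  have m120 : 0 < 4 * (m1%:R * m2%:R) :> R by rewrite !mulr_gt0.
  apply: expr1D_le2.
    apply: mulr_ge0; first exact: mulr_ge0 (sqr_ge0 _) (ltW Q0).
    exact: divr_ge0 (sqr_ge0 _) (ltW m120).
  rewrite mulrCA -[leRHS]mulr1.
  have c11 : c1 <= 1 by apply: le_trans B1; rewrite -[leLHS]mulr1; apply: c1B; lra.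
  have cQ : c1 ^+ 2 * Q <= ln 2.
    apply: le_trans Bln; apply: (@le_trans _ _ (c1 * Q)); last by apply: c1B; lra.
    by rewrite ler_wpM2r ?(ltW Q0)// expr2 ler_piMr// ltW.
  apply: ler_pM => //; first exact: mulr_ge0 (sqr_ge0 _) (ltW Q0).
    exact: mulr_ge0 (ler0n _ _) (divr_ge0 (sqr_ge0 _) (ltW m120)).
  by rewrite [leLHS]mulrA ler_pdivrMr// mul1r.
have [s Hs] := hypercube_risk ab1 a20 ab2 m10 m20 deg_gt1 eps0 eps1 gam0 dM gam1
  dfd fdh mest (powR_ge0 n%:R (betabar / (betabar + 1))) chi2.
apply: (@le_trans _ _ (risk A1 A2 fd (betabar / (betabar + 1)) est
    (hyp_cdf a1 b1 a2 b2 deg eps gam s))); last first.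
  apply: ereal_sup_ubound; exists (hyp_cdf a1 b1 a2 b2 deg eps gam s) => //.
  split; first exact: (hyp_cdf_cond_cdf _ _ a20 ab2 m20 deg_gt1 eps0 gam0 dM gam1).
  exact: (besov_hyp_cdf ab1 a20 ab2 m10 m20 deg_gt1 eps0 eps1 gam0 M1 dM gam1
    be1 be2 deg1 deg2 gam2 gam3 eps2).
apply: le_trans Hs; rewrite lee_fin le_eqVlt; apply/orP; left; apply/eqP.
rewrite /separation /width1 /width2 -/W1 -/W2 /gam.
set N := n%:R `^ _; rewrite -/N in r5.
set E := (3 / 16) ^+ deg ^+ 4.
transitivity (c1 ^+ 2 * (E / 2 * (W1 / 2) * (W2 / 2) / 4) * (N * rho ^+ 2)).
  by rewrite r5 mulr1.
by field; rewrite !gt_eqF.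
Qed.
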